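(* Let $n\ge1$, let $q$ be a square, and let $f$ be a non-degenerate unitary (Hermitian) form on $\mathbb{F}_q^{2n}$ with polarity $\perp$. Put $k=z_n(q)-1$ and define $v_f$ on the chambers of $\mathbb{F}_q^{2n}$ by $v_f(C)=-k$ if $C_{n+i}=C_{n-i}^\perp$ for all $i=0,\dots,n-1$; $v_f(C)=1$ if $C_n=C_n^\perp$ but $C_{n+i}\ne C_{n-i}^\perp$ for some $i\in\{1,\dots,n-1\}$; $v_f(C)=0$ if $C_n\ne C_n^\perp$. Then $v_f$ is an antidesign of $\Gamma_{2n}(q)$ and $\mathds{1}^\top v_f=0$.
   Context: A chamber of $\mathbb{F}_q^{2n}$ is a set $C=\{C_1,\dots,C_{2n-1}\}$ of subspaces with $C_1\subset\cdots\subset C_{2n-1}$, $\dim C_i=i$ (with $C_0=\{0\}$, $C_{2n}=\mathbb{F}_q^{2n}$ where needed); chambers $C,D$ are opposite if $C_i\cap D_{2n-i}=\{0\}$ for all $i$. $\Gamma_{2n}(q)$ is the graph on chambers with adjacency being oppositeness. Functions on chambers are vectors indexed by chambers, $\mathds{1}$ the all-ones vector. An antidesign is a function $v$ from chambers to $\mathbb{Q}$ with $e^\top v=0$ for all $e$ in the eigenspace of $\Gamma_{2n}(q)$ for its smallest eigenvalue. $z_n(q)=(q-1)^{-n}\prod_{i=1}^n(q^i-1)$ is the number of chambers of $\mathbb{F}_q^n$. *)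

(* Defs.v *)
From HB Require Import structures.
From mathcomp Require Import all_boot all_order all_algebra.
From mathcomp Require Import reals.

Set Implicit Arguments.
Unset Strict Implicit.
Unset Printing Implicit Defensive.
Import Order.TTheory GRing.Theory Num.Theory.
Local Open Scope ring_scope.

HB.instance Definition _ (F : finFieldType) (vT : vectType F)
    : isCountable {vspace vT} := CanIsCountable (@VectorInternalTheory.vs2mxK F vT).
HB.instance Definition _ (F : finFieldType) (vT : vectType F)
    : isFinite {vspace vT} := CanIsFinite (@VectorInternalTheory.vs2mxK F vT).

Section Chambers.
Variables (F : finFieldType) (m : nat).

(* A chamber {C_1, ..., C_(m-1)} is stored as the family (C_0, ..., C_m); the
   dimension condition forces C_0 = 0 and C_m = F^m, so this adds no data. *)
Definition is_chamber (C : {ffun 'I_m.+1 -> {vspace 'rV[F]_m}}) : bool :=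
  [forall i, \dim (C i) == i] &&
  [forall i : 'I_m.+1, forall j : 'I_m.+1, (i <= j)%N ==> (C i <= C j)%VS].

Definition chamber := {C : {ffun 'I_m.+1 -> {vspace 'rV[F]_m}} | is_chamber C}.

(* C_i, meaningful for i <= m. *)
Definition part (C : chamber) (i : nat) : {vspace 'rV[F]_m} := val C (inord i).

(* The indices i = 0 and i = m are included: they impose no condition. *)
Definition opposite : rel chamber := fun C D =>
  [forall i : 'I_m.+1, (part C i :&: part D (m - i) == 0)%VS].

Definition opp_adjmx (R : realType) : 'M[R]_#|{: chamber}| :=
  \matrix_(i, j) (opposite (enum_val i) (enum_val j))%:R.

Definition smallest_eigenvalue (R : realType) p (A : 'M[R]_p) (a : R) : Prop :=
  eigenvalue A a /\ (forall b : R, eigenvalue A b -> a <= b).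

(* [eigenspace] consists of row vectors; opp_adjmx being symmetric, these are
   the transposes of the usual eigenvectors. *)
Definition antidesign (R : realType) (v : chamber -> rat) : Prop :=
  exists2 a : R, smallest_eigenvalue (opp_adjmx R) a &
    forall e : 'rV[R]_#|{: chamber}|, (e <= eigenspace (opp_adjmx R) a)%MS ->
      \sum_(C : chamber) e 0 (enum_rank C) * ratr (v C) = 0.

End Chambers.

Definition z_num (n q : nat) : rat :=
  (q%:R - 1) ^- n * \prod_(1 <= i < n.+1) (q%:R ^+ i - 1).

Section UnitaryFunction.
Variables (F : finFieldType) (theta : {rmorphism F -> F}) (n : nat).
Variable f : {hermitian_sym 'rV[F]_(2 * n) for theta}.

(* orthov f U is U^perp with respect to f. *)
Definition v_f (C : chamber F (2 * n)) : rat :=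
  if [forall i : 'I_n, part C (n + i) == orthov f (part C (n - i))]
  then - (z_num n #|F| - 1)
  else if part C n == orthov f (part C n) then 1
  else 0.

End UnitaryFunction.

(* Main.v *)
From HB Require Import structures.
Require Import Defs.
From mathcomp Require Import all_boot all_order all_algebra.
From mathcomp Require Import reals.
From mathcomp Require Import finfield.
From mathcomp Require Import ring lra zify.

(* Write m = 2n and q = #|F|, let A be the opposition matrix, S_i the matrix of
   the relation "equal except possibly at C_i" and T_i = S_i - 1. Then
   S_i^2 = (q + 1) S_i, A S_i = S_(m-i) A, and A is a product of T_i's in which
   T_i occurs i times.

   Let b < 0 be an eigenvalue of A. The space W of eigenvectors of A^2 for b^2
   orthogonal to the all-ones vector is stable under all S_i; put d = dim W and
   let r_i be the dimension of its subspace K_i fixed by S_i / (q + 1). Taking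
   determinants of A^2 on W and using r_i = r_(m-i) gives
   b^(2d) = q^(m (r_1 + ... + r_(m-1))). A vector fixed by all S_i / (q + 1) is
   constant, so the K_i meet trivially and r_1 + ... + r_(m-1) <= (m - 2) d.
   Hence b >= - q^(n(m-2)), a bound that is attained, and in the case of
   equality a dimension count shows that W is the sum of the intersection of the
   K_i with i > n and of the intersection of the K_i with i < n. An eigenvector
   for the smallest eigenvalue is therefore a function of (C_1, ..., C_n) plus a
   function of (C_n, ..., C_(m-1)).

   Finally v_f sums to 0 over the z_n(q) chambers that extend a given lower half
   or a given upper half: if C_n = C_n^perp exactly one of them satisfies
   C_(n+i) = C_(n-i)^perp for all i. *)

Set Implicit Arguments.
Unset Strict Implicit.
Unset Printing Implicit Defensive.
Import Order.TTheory GRing.Theory Num.Theory.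
Local Open Scope ring_scope.

(** * Quasi-idempotent matrices *)

Lemma det_1subM_comm (R : comNzRingType) m n (U : 'M[R]_(m, n)) (V : 'M_(n, m)) :
  \det (1%:M - U *m V) = \det (1%:M - V *m U).
Proof.
have <- : \det (block_mx 1%:M V U 1%:M) = \det (1%:M - U *m V).
  have -> : block_mx 1%:M V U 1%:M
      = block_mx 1%:M 0 U 1%:M *m block_mx 1%:M V 0 (1%:M - U *m V).
    by rewrite mulmx_block !(mulmx0, mul0mx, mul1mx, mulmx1, addr0) addrC subrK.
  by rewrite det_mulmx det_lblock det_ublock !det1 !mul1r.
have -> : block_mx 1%:M V U 1%:M
    = block_mx (1%:M - V *m U) V 0 1%:M *m block_mx 1%:M 0 U 1%:M.
  by rewrite mulmx_block !(mulmx0, mul0mx, mul1mx, mulmx1, add0r, addr0) subrK.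
by rewrite det_mulmx det_lblock det_ublock !det1 !mulr1.
Qed.

Section QuasiIdempotent.
Variables (K : fieldType) (c : K).

Lemma quasi_idem_det d (s : 'M[K]_d) :
  s *m s = c *: s -> \det (s - 1%:M) ^+ 2 = ((c - 1) ^+ 2) ^+ \rank s.
Proof.
move=> ss; set U := col_base s; set V := row_base s.
have VU : V *m U = c%:M.
  have Ufree : row_full U by apply: col_base_full.
  have Vfree : row_free V by apply: row_base_free.
  apply: (row_free_inj Vfree); apply: (row_full_inj Ufree).
  have sE : U *m V = s by exact: mulmx_base.
  by rewrite -(mulmxA V) sE mulmxA sE ss mul_scalar_mx -scalemxAr sE.
rewrite -[s in LHS]mulmx_base -/U -/V -opprB -scaleN1r detZ det_1subM_comm VU.
have -> : 1%:M - c%:M = (1 - c)%:M :> 'M[K]_(\rank s) by rewrite raddfB.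
rewrite det_scalar.
by rewrite exprMn sqrr_sign mul1r -!exprM mulnC exprM -sqrrN opprB -exprM mulnC.
Qed.

Lemma quasi_idem_eigenspace d (s : 'M[K]_d) : c != 0 ->
  s *m s = c *: s -> (eigenspace s c :=: s)%MS.
Proof.
move=> c0 ss; apply/eqmxP/andP; split.
  have /eigenspaceP e := submx_refl (eigenspace s c).
  by rewrite -[X in (X <= _)%MS](scalerK c0) -e scalemx_sub ?submxMl.
by apply/eigenspaceP.
Qed.

Lemma rank_eigenspace_restrict p (W f : 'M[K]_p) a : stablemx W f ->
  \rank (eigenspace (restrictmx W f) a) = \rank (W :&: eigenspace f a)%MS.
Proof.
move=> Wf; have rf := row_base_free W.
have Wf' : stablemx (row_base W) f by rewrite stablemx_row_base.
have Wsub X : (X <= W)%MS -> exists Y, X = Y *m row_base W :> 'M_p.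
  by rewrite -(eq_row_base W) => /submxP.
rewrite -(mxrankMfree _ rf); apply: eqmx_rank; apply/andP; split.
  rewrite sub_capmx -sub_eigenspace_conjmx // submx_refl andbT.
  by rewrite -(eq_row_base W) submxMl.
have [Y eY] := Wsub _ (capmxSl W (eigenspace f a)).
rewrite {1}eY submxMr // sub_eigenspace_conjmx // -eY; exact: capmxSr.
Qed.

Lemma det_restrict_quasi_idem p (W s : 'M[K]_p) : c != 0 ->
  stablemx W s -> s *m s = c *: s ->
  \det (restrictmx W (s - 1%:M)) ^+ 2
    = ((c - 1) ^+ 2) ^+ \rank (W :&: eigenspace s c)%MS.
Proof.
move=> c0 Ws ss.
have e : restrictmx W (s - 1%:M) = restrictmx W s - 1%:M.
  by rewrite /conjmx mulmxBr mulmx1 mulmxBl (mulmxVp (row_base_free W)).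
have rss : restrictmx W s *m restrictmx W s = c *: restrictmx W s.
  by rewrite -conjmxM ?inE ?stablemx_row_base // ss /conjmx -scalemxAr -scalemxAl.
rewrite e quasi_idem_det // -rank_eigenspace_restrict //.
by rewrite (quasi_idem_eigenspace c0 rss).
Qed.

Lemma rank_cap_bigcap p (W : 'M[K]_p) (L : nat -> 'M[K]_p) (r : seq nat) :
  (\rank W + \sum_(i <- r) \rank (W :&: L i)%MS
    <= \rank (W :&: \bigcap_(i <- r) L i)%MS + size r * \rank W)%N.
Proof.
elim: r => [|j r IH]; first by rewrite !big_nil capmx1 mul0n.
rewrite !big_cons /=.
set X := (\bigcap_(i <- r) L i)%MS in IH *.
have := mxrank_sum_cap (W :&: L j)%MS (W :&: X)%MS.
have : (\rank (W :&: L j + W :&: X)%MS <= \rank W)%N.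
  by apply: mxrankS; rewrite addsmx_sub !capmxSl.
have -> : \rank (W :&: L j :&: (W :&: X))%MS = \rank (W :&: (L j :&: X))%MS.
  apply: eqmx_rank; apply/andP; rewrite !sub_capmx.
  have h1 := capmxSl W (L j :&: X)%MS.
  have h2 := submx_trans (capmxSr W (L j :&: X)%MS) (capmxSl _ _).
  have h3 := submx_trans (capmxSr W (L j :&: X)%MS) (capmxSr _ _).
  rewrite h1 h2 h3; split=> //.
  have g1 := submx_trans (capmxSl (W :&: L j)%MS (W :&: X)%MS) (capmxSl _ _).
  have g2 := submx_trans (capmxSl (W :&: L j)%MS (W :&: X)%MS) (capmxSr _ _).
  have g3 := submx_trans (capmxSr (W :&: L j)%MS (W :&: X)%MS) (capmxSr _ _).
  by rewrite g1 g2 g3.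
move=> h1 h2; rewrite mulSn; lia.
Qed.

End QuasiIdempotent.

(** * Spectrum of a product of quasi-idempotents *)

Lemma word_ind m (P : nat -> Prop) :
  P m.-1 -> (forall l, (l.+1 < m)%N -> P l.+1 -> P l) ->
  forall l, (l < m)%N -> P l.
Proof.
move=> P0 IH l lm; have -> : l = (m.-1 - (m.-1 - l))%N by lia.
elim: (m.-1 - l)%N => [|k IHk]; first by rewrite subn0.
have [le|lt] := leqP m.-1 k; first by have -> : (m.-1 - k.+1 = m.-1 - k)%N by lia.
by apply: IH; first lia; have -> : (m.-1 - k.+1).+1 = (m.-1 - k)%N by lia.
Qed.

Section WordSpectrum.
Variables (R : realFieldType) (p m : nat) (q : R) (S Y B : nat -> 'M[R]_p).
Hypotheses (m_gt0 : (0 < m)%N) (q_gt1 : 1 < q).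
Hypothesis SS : forall i, (0 < i < m)%N -> S i *m S i = (q + 1) *: S i.
Hypothesis SB : forall i, (0 < i < m)%N -> S i *m B 0 = B 0 *m S (m - i).
Hypothesis Ylast : Y m.-1 = 1%:M.
Hypothesis Yrec :
  forall l, (l.+1 < m)%N -> Y l = Y l.+1 *m (S l.+1 - 1%:M).
Hypothesis Blast : B m.-1 = 1%:M.
Hypothesis Brec : forall l, (l.+1 < m)%N -> B l = Y l *m B l.+1.
Variables (W : 'M[R]_p) (lam : R).
Hypothesis WS : forall i, (0 < i < m)%N -> stablemx W (S i).
Hypothesis lam_neq0 : lam != 0.
Hypothesis Wlam : W *m (B 0 *m B 0) = lam *: W.
Hypothesis Winv :
  (W :&: \bigcap_(i <- index_iota 1 m) eigenspace (S i) (q + 1))%MS = 0.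

Let r i := \rank (W :&: eigenspace (S i) (q + 1))%MS.
Let d := \rank W.
Let q_gt0 : 0 < q := lt_trans ltr01 q_gt1.
Let q_neq1 : q != 1 := negbT (gt_eqF q_gt1).

Lemma word_stable l : (l < m)%N -> stablemx W (Y l) /\ stablemx W (B l).
Proof.
move: l; apply: word_ind => [|l lm [sY sB]].
  by rewrite Ylast Blast stablemxC.
have sY' : stablemx W (Y l).
  by rewrite Yrec // stablemxM // stablemxD ?stablemxN ?stablemxC // WS //; lia.
by split; rewrite // Brec // stablemxM.
Qed.

Lemma restrict_mul (f g : 'M[R]_p) : stablemx W f -> stablemx W g ->
  restrictmx W (f *m g) = restrictmx W f *m restrictmx W g.
Proof. by move=> *; rewrite conjmxM // inE stablemx_row_base. Qed.

Lemma det_restrict1 : \det (restrictmx W (1%:M : 'M[R]_p)) = 1.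
Proof. by rewrite conjmx_scalar ?row_base_free // det1. Qed.

Lemma det_Y l : (l < m)%N ->
  \det (restrictmx W (Y l)) ^+ 2 = (q ^+ 2) ^+ (\sum_(l.+1 <= i < m) r i).
Proof.
move: l; apply: word_ind => [|l lm IH].
  by rewrite Ylast det_restrict1 expr1n big_geq ?expr0 //; lia.
have hl : (0 < l.+1 < m)%N by lia.
rewrite Yrec // restrict_mul ?(word_stable lm).1 //; last first.
  by rewrite stablemxD ?stablemxN ?stablemxC // WS.
have q1 : q + 1 != 0 by rewrite gt_eqF // addr_gt0.
rewrite det_mulmx exprMn IH (det_restrict_quasi_idem q1 (WS hl) (SS hl)).
rewrite addrK -exprD; congr (_ ^+ _).
by rewrite [RHS]big_ltn // addnC.
Qed.

Lemma det_B l : (l < m)%N ->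
  \det (restrictmx W (B l)) ^+ 2
    = (q ^+ 2) ^+ (\sum_(l.+1 <= i < m) (i - l) * r i).
Proof.
move: l; apply: word_ind => [|l lm IH].
  by rewrite Blast det_restrict1 expr1n big_geq ?expr0 //; lia.
have ll := ltnW lm.
rewrite Brec // restrict_mul ?(word_stable lm).2 ?(word_stable ll).1 //.
rewrite det_mulmx exprMn IH det_Y // -exprD; congr (_ ^+ _).
rewrite [in X in (_ + X)%N](_ : \sum_(l.+2 <= i < m) (i - l.+1) * r i
    = \sum_(l.+1 <= i < m) (i - l.+1) * r i)%N.
  rewrite -big_split /= big_nat [RHS]big_nat; apply: eq_bigr => i hi.
  by rewrite -mulSn; congr (_ * _)%N; lia.
by rewrite [RHS]big_ltn // subnn mul0n.
Qed.

(* [A] maps the fixed space of [S_i] injectively into that of [S_(m-i)]. *)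
Lemma rank_fix_sym i : (0 < i < m)%N -> r i = r (m - i).
Proof.
have le j : (0 < j < m)%N -> (r j <= r (m - j))%N.
  move=> hj; rewrite /r; set K := (W :&: eigenspace (S j) _)%MS.
  have KW : (K <= W)%MS by exact: capmxSl.
  have KB : K *m B 0 *m B 0 = lam *: K.
    have /submxP[X ->] := KW; rewrite -!mulmxA [W *m _]mulmxA -(mulmxA W).
    by rewrite Wlam scalemxAr.
  have le1 : (\rank K <= \rank (K *m B 0))%N.
    by rewrite -(eqmx_scale K lam_neq0) -KB mxrankM_maxl.
  apply: leq_trans le1 _; apply: mxrankS; rewrite sub_capmx; apply/andP; split.
    apply: submx_trans (submxMr _ KW) _; exact: (word_stable m_gt0).2.
  apply/eigenspaceP; rewrite -mulmxA -SB // mulmxA.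
  have /eigenspaceP-> := capmxSr W (eigenspace (S j) (q + 1)).
  by rewrite -scalemxAl.
move=> hi; apply/eqP; rewrite eqn_leq le //=.
have {2}-> : i = (m - (m - i))%N by lia.
by apply: le; lia.
Qed.

Lemma sum_weighted : (2 * \sum_(1 <= i < m) i * r i = m * \sum_(1 <= i < m) r i)%N.
Proof.
rewrite mul2n -addnn {1}big_nat_rev /= -big_split big_distrr /= big_nat [RHS]big_nat.
apply: eq_bigr => i hi; rewrite (_ : 1 + m - i.+1 = m - i)%N; last lia.
rewrite -rank_fix_sym //; nia.
Qed.

Lemma lam_power : lam ^+ d = q ^+ (m * \sum_(1 <= i < m) r i).
Proof.
have sB := (word_stable m_gt0).2.
have e : restrictmx W (B 0) *m restrictmx W (B 0) = lam%:M.
  rewrite -restrict_mul //; apply: (row_free_inj (row_base_free W)).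
  rewrite mulmxKpV ?stablemx_row_base ?stablemxM // mul_scalar_mx.
  have : (row_base W <= W)%MS by rewrite eq_row_base.
  by move=> /submxP[X eX]; rewrite [in LHS]eX [in RHS]eX -mulmxA Wlam scalemxAr.
rewrite -det_scalar -e det_mulmx -expr2 det_B // -exprM -sum_weighted.
by congr (_ ^+ (_ * _)); apply: eq_bigr => i _; rewrite subn0.
Qed.

Lemma sum_rank_fix : (1 < m)%N -> (\sum_(1 <= i < m) r i <= (m - 2) * d)%N.
Proof.
move=> m1; have := rank_cap_bigcap W (fun i => eigenspace (S i) (q + 1)) (index_iota 1 m).
rewrite Winv mxrank0 size_iota -/d add0n.
have -> : (m - 1 = (m - 2).+1)%N by lia.
by rewrite mulSn leq_add2l.
Qed.

Lemma lam_bound : (1 < m)%N -> (0 < d)%N -> 0 <= lam -> lam <= q ^+ (m * (m - 2)).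
Proof.
move=> m1 d0 l0; rewrite -(@ler_pXn2r _ d) ?nnegrE ?exprn_ge0 // ?(ltW q_gt0) //.
rewrite lam_power -exprM ler_eXn2l //.
by rewrite -mulnA leq_mul2l sum_rank_fix // orbT.
Qed.

Lemma extremal_split n : m = (2 * n)%N -> (0 < n)%N -> lam = q ^+ (m * (m - 2)) ->
  (W <= (W :&: \bigcap_(i <- index_iota n.+1 m) eigenspace (S i) (q + 1))
      + (W :&: \bigcap_(i <- index_iota 1 n) eigenspace (S i) (q + 1)))%MS.
Proof.
move=> em n0 elam; set L := (W :&: _)%MS; set U := (W :&: _)%MS.
have m1 : (1 < m)%N by lia.
have sumr : (\sum_(1 <= i < m) r i = (m - 2) * d)%N.
  have := lam_power; rewrite elam -exprM => /eqP.
  rewrite (inj_eq (ieexprIn q_gt0 q_neq1)).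
  by rewrite -mulnA eqn_pmul2l; [move=> /eqP <-|lia].
have hL : (d + \sum_(n.+1 <= i < m) r i <= \rank L + (m - n.+1) * d)%N.
  rewrite -(size_iota n.+1 (m - n.+1)).
  exact: (rank_cap_bigcap W (fun i => eigenspace (S i) (q + 1))).
have hU : (d + \sum_(1 <= i < n) r i <= \rank U + (n - 1) * d)%N.
  rewrite -(size_iota 1 (n - 1)).
  exact: (rank_cap_bigcap W (fun i => eigenspace (S i) (q + 1))).
have sI : (L :&: U :&: (W :&: eigenspace (S n) (q + 1)))%MS = 0.
  apply/eqP; rewrite -submx0 -Winv.
  rewrite (@big_cat_nat _ _ _ n) /=; [|lia|lia].
  rewrite [X in (_ <= _ :&: (_ :&: X))%MS]big_ltn; last lia.
  set E := eigenspace _ _; rewrite /L /U.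
  set P := (\bigcap_(i <- _) _)%MS; set Q := (\bigcap_(i <- _) _)%MS.
  have := submx_refl (W :&: P :&: (W :&: Q) :&: (W :&: E))%MS.
  by rewrite !sub_capmx => /andP[/andP[/andP[-> ->] /andP[_ ->]] /andP[_ ->]].
have := mxrank_sum_cap L U.
have := mxrank_sum_cap (L :&: U)%MS (W :&: eigenspace (S n) (q + 1))%MS.
rewrite sI mxrank0 addn0 -/(r n).
have : (\rank (L :&: U + W :&: eigenspace (S n) (q + 1))%MS <= d)%N.
  by apply: mxrankS; rewrite addsmx_sub !capmxSl (submx_trans (capmxSl _ _)) // capmxSl.
have sumr' : (\sum_(1 <= i < n) r i + (r n + \sum_(n.+1 <= i < m) r i)
              = (m - 2) * d)%N.
  by rewrite -sumr [RHS](@big_cat_nat _ _ _ n) //= ?[in RHS](@big_ltn _ _ _ n) //; lia.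
move=> h1 h2 h3.
have LUW : (L + U <= W)%MS by rewrite addsmx_sub !capmxSl.
rewrite -(mxrank_leqif_sup LUW) eqn_leq mxrankS //= -/d.
move: sumr' hL hU h1 h2 h3 => {sumr}.
move: (\sum_(1 <= i < n) r i)%N (\sum_(n.+1 <= i < m) r i)%N => u v.
move: (\rank L) (\rank U) (\rank (L + U)%MS) (\rank (L :&: U)%MS) => a b c e.
rewrite (_ : m - 2 = (n - 1) + (n - 1))%N; last lia.
rewrite (_ : m - n.+1 = n - 1)%N; last lia.
rewrite mulnDl; move: ((n - 1) * d)%N => x; lia.
Qed.

End WordSpectrum.

(** * Subspaces and chambers *)

Lemma card_pred_le1 (T : finType) (P : pred T) (x0 : T) :
  (forall x, P x -> x = x0) -> #|P| = P x0.
Proof.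
move=> h; case: (boolP (P x0)) => Px0 /=.
  rewrite -(card1 x0); apply: eq_card => x; rewrite !inE.
  by apply/idP/eqP => [/h|->].
apply: eq_card0 => x; apply/negP => Px.
by move/negP: Px0; apply; rewrite -(h _ Px); exact: Px.
Qed.

Section Subspaces.
Variables (K : fieldType) (vT : vectType K).
Implicit Types U V : {vspace vT}.

Lemma dim_addv_line U w : w \notin U -> \dim (U + <[w]>) = (\dim U).+1.
Proof.
move=> wU; have w0 : w != 0 by apply: contraNneq wU => ->; rewrite mem0v.
rewrite dimv_disjoint_sum ?dim_vline ?w0 ?addn1 //.
apply/eqP; rewrite -subv0; apply/subvP => x; rewrite memv_cap => /andP[xU].
case/vlineP=> a ex; rewrite memv0; have [a0|a0] := eqVneq a 0; last first.
  by move: wU; rewrite -[w](scalerK a0) -ex memvZ //.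
by rewrite ex a0 scale0r.
Qed.

Lemma addv_line_eq U V w : (U <= V)%VS -> w \in V -> w \notin U ->
  \dim V = (\dim U).+1 -> (U + <[w]>)%VS = V.
Proof.
move=> UV wV wU dV; apply/eqP; rewrite eqEdim dim_addv_line // dV leqnn andbT.
by rewrite subv_add UV -memvE.
Qed.

Lemma exists_notin U V : (\dim U < \dim V)%N -> exists2 w, w \in V & w \notin U.
Proof.
by move=> dUV; apply/subvPn; apply: contraL dUV => /dimvS; rewrite -leqNgt.
Qed.

Lemma eqv_dim U V : (U <= V)%VS -> \dim U = \dim V -> U = V.
Proof. by move=> UV dUV; apply/eqP; rewrite eqEdim UV dUV leqnn. Qed.

End Subspaces.

Section ChamberBasics.
Variables (F : finFieldType) (m : nat).
Local Notation chamber := (chamber F m).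
Implicit Types (C D E : chamber) (i j k l t : nat).
Local Notation q := #|F|.

Lemma card_vspace_rV (U : {vspace 'rV[F]_m}) :
  #|[pred w | w \in U]| = (q ^ \dim U)%N.
Proof.
exact: (@card_vspace F 'rV[F]_m (Vector.class 'rV[F]_m) U).
Qed.

Lemma card_vspaceD (U V : {vspace 'rV[F]_m}) : (U <= V)%VS ->
  #|[pred w | (w \in V) && (w \notin U)]| = (q ^ \dim V - q ^ \dim U)%N.
Proof.
move=> /subvP UV; rewrite -!card_vspace_rV.
rewrite -(cardID [pred w | w \in U] [pred w | w \in V]).
rewrite [X in (X + _)%N](_ : _ = #|[pred w | w \in U]|); last first.
  by apply: eq_card => w; rewrite !inE andb_idl // => /UV.
by rewrite addKn; apply: eq_card => w; rewrite !inE andbC.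
Qed.

Lemma part_dim C i : (i <= m)%N -> \dim (part C i) = i.
Proof.
move=> im; have /andP[/forallP/(_ (inord i))/eqP h _] := valP C.
by rewrite /part h inordK.
Qed.

Lemma part_le C i j : (i <= j <= m)%N -> (part C i <= part C j)%VS.
Proof.
move=> /andP[ij jm]; have /andP[_ /forallP/(_ (inord i))] := valP C.
move=> /forallP/(_ (inord j))/implyP; apply.
by rewrite !inordK // ltnS (leq_trans ij).
Qed.

Lemma part0 C : part C 0 = 0%VS.
Proof. by apply/eqP; rewrite -dimv_eq0 part_dim. Qed.

Lemma partm C : part C m = fullv.
Proof.
apply/eqv_dim; first exact: subvf.
by rewrite part_dim // dimvf /dim /= mul1n.
Qed.

Lemma chamber_eqP C D :
  (forall i, (0 < i < m)%N -> part C i = part D i) -> C = D.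
Proof.
move=> h; apply/val_inj/ffunP => i.
have := ltn_ord i; rewrite ltnS leq_eqVlt => /orP[/eqP im|im].
  have := etrans (partm C) (esym (partm D)); rewrite /part.
  by have -> : inord m = i by apply/val_inj; rewrite /= inordK.
have [i0|i0] := posnP i.
  have := etrans (part0 C) (esym (part0 D)); rewrite /part.
  by have -> : inord 0 = i by apply/val_inj; rewrite /= inordK.
by have := h i; rewrite i0 im /part inord_val; apply.
Qed.

Lemma mk_chamber (g : nat -> {vspace 'rV[F]_m}) :
  (forall i, (i <= m)%N -> \dim (g i) = i) ->
  (forall i, (i < m)%N -> (g i <= g i.+1)%VS) ->
  {C : chamber | forall i, (i <= m)%N -> part C i = g i}.
Proof.
move=> gd gS.
have gle i j : (i <= j <= m)%N -> (g i <= g j)%VS.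
  move=> /andP[ij jm]; rewrite -(subnKC ij).
  have : (i + (j - i) <= m)%N by rewrite subnKC.
  elim: (j - i)%N => [|k IH] h; first by rewrite addn0.
  by rewrite addnS; apply: subv_trans (IH _) (gS _ _); rewrite addnS in h; lia.
pose c := [ffun i : 'I_m.+1 => g i].
have cP : is_chamber c.
  apply/andP; split; first by apply/forallP => i; rewrite ffunE gd // -ltnS.
  apply/forallP => i; apply/forallP => j; apply/implyP => ij; rewrite !ffunE.
  by apply: gle; rewrite ij /= -ltnS ltn_ord.
by exists (Sub c cP) => i im; rewrite /part SubK ffunE inordK.
Qed.

Lemma chamber_exists : chamber.
Proof.
have dm : \dim {: 'rV[F]_m} = m by rewrite dimvf /dim /= mul1n.
have fb : free (vbasis {: 'rV[F]_m}) := basis_free (vbasisP _).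
pose g i := <<take i (vbasis {: 'rV[F]_m})>>%VS.
have gd i : (i <= m)%N -> \dim (g i) = i.
  move=> im; have : free (take i (vbasis {: 'rV[F]_m})).
    by apply: (@catl_free _ _ (drop i (vbasis {: 'rV[F]_m}))); rewrite cat_take_drop.
  by rewrite /free => /eqP ->; rewrite size_takel // size_tuple dm.
have gS i : (i < m)%N -> (g i <= g i.+1)%VS.
  move=> im; rewrite /g (take_nth 0) ?size_tuple ?dm //; apply: sub_span => x.
  by rewrite mem_rcons inE orbC => ->.
by case: (mk_chamber gd gS).
Qed.

End ChamberBasics.

(** * Chambers that agree outside an interval of types *)

Section Insertion.
Variables (F : finFieldType) (m : nat).
Local Notation chamber := (chamber F m).
Implicit Types (C D E : chamber) (i j k l t : nat) (w : 'rV[F]_m).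
Local Notation q := #|F|.

Lemma ins_subproof t w C : {D : chamber | forall i, (i <= m)%N ->
  part D i = if (i <= t)%N || (w \in part C i) then part C i
             else (part C i.-1 + <[w]>)%VS}.
Proof.
apply: mk_chamber => i im.
  case: ifP => [_|/negbT]; first by rewrite part_dim.
  rewrite negb_or -ltnNge => /andP[ti wi].
  have wi' : w \notin part C i.-1.
    by apply: contra wi; apply/subvP/part_le; lia.
  by rewrite dim_addv_line // part_dim; lia.
have [it|ti] := leqP i t; rewrite /=.
  have [_|_] := leqP i.+1 t; rewrite /=; first by apply: part_le; lia.
  by case: ifP => _; rewrite ?(subv_trans _ (addvSl _ _)) //; apply: part_le; lia.
have -> : (i < t)%N = false by lia.
have Ci : (part C i <= part C i.+1)%VS by apply: part_le; lia.
have Ci' : (part C i.-1 <= part C i)%VS by apply: part_le; lia.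
rewrite /=; case: ifP => wi.
  by rewrite (subvP Ci _ wi).
case: ifP => wi'; last exact: addvS.
by rewrite subv_add (subv_trans Ci' Ci) -memvE.
Qed.

(* [C] with [w] pushed into every term beyond the [t]-th. *)
Definition ins t w C : chamber := sval (ins_subproof t w C).

Lemma part_ins t w C i : (i <= m)%N ->
  part (ins t w C) i = if (i <= t)%N || (w \in part C i) then part C i
                       else (part C i.-1 + <[w]>)%VS.
Proof. exact: (svalP (ins_subproof t w C)). Qed.

Lemma part_ins_add t w C i : (t < i <= m)%N -> w \notin part C i.-1 ->
  part (ins t w C) i = (part C i.-1 + <[w]>)%VS.
Proof.
move=> hi wi; rewrite part_ins; last lia.
have -> : (i <= t)%N = false by lia.
case: ifP => //= wi'; apply/esym/addv_line_eq => //; first by apply: part_le; lia.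
by rewrite !part_dim; lia.
Qed.

Definition eqout l k C D : bool :=
  [forall i : 'I_m.+1, ((i <= l) || (k <= i))%N ==> (part C i == part D i)].

Lemma eqoutP l k C D :
  reflect (forall i, (i <= m)%N -> ((i <= l) || (k <= i))%N -> part C i = part D i)
          (eqout l k C D).
Proof.
apply: (iffP forallP) => [h i im hi|h i]; last first.
  by apply/implyP => hi; apply/eqP/h; rewrite // -ltnS.
by apply/eqP; have /implyP := h (inord i); rewrite inordK //; apply.
Qed.

Lemma eqout_refl l k C : eqout l k C C.
Proof. by apply/eqoutP. Qed.

Lemma eqout_sym l k C D : eqout l k C D = eqout l k D C.
Proof. by apply/eqoutP/eqoutP => h i im hi; rewrite h. Qed.

Lemma eqout_trans l k C D E : eqout l k C D -> eqout l k D E -> eqout l k C E.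
Proof. by move=> /eqoutP h /eqoutP g; apply/eqoutP => i im hi; rewrite h // g. Qed.

Lemma eqout_eq l k C D : (k <= l.+1)%N -> eqout l k C D = (C == D).
Proof.
move=> kl; apply/idP/eqP => [/eqoutP h|->]; last exact: eqout_refl.
by apply: chamber_eqP => i hi; apply: h; lia.
Qed.

Lemma eqout_ins l k w C B : (l < k <= m)%N -> w \in part B k -> w \notin part B l ->
  eqout l k C B && (w \in part C l.+1) = eqout l.+1 k C (ins l w B).
Proof.
move=> hlk wk wl; apply/andP/eqoutP => [[/eqoutP h wC] i im hi|h].
  have [il|li] := leqP i l; first by rewrite part_ins // il h ?il.
  have [ki|ik] := leqP k i.
    rewrite part_ins // (subvP (part_le _ _) _ wk) ?orbT; last lia.
    by rewrite h // ki orbT.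
  have ei : i = l.+1 by lia.
  rewrite ei part_ins_add //=; last lia.
  apply/esym/addv_line_eq => //; last by rewrite !part_dim; lia.
  by rewrite -h ?leqnn //; [apply: part_le|]; lia.
split.
  apply/eqoutP => i im hi; rewrite h //; last lia.
  rewrite part_ins //; case: ifP => // /negbT.
  case/orP: hi => [->//|ki]; rewrite (subvP (part_le _ _) _ wk) ?orbT //; lia.
rewrite h ?leqnn //; last lia.
by rewrite part_ins_add //= ?(subvP (addvSr _ _) _ (memv_line w)) //; lia.
Qed.

Lemma eqout_connect (T : Type) (g : chamber -> T) l k C D : (l <= k <= m)%N ->
  (forall j C D, (l < j < k)%N -> eqout j.-1 j.+1 C D -> g C = g D) ->
  eqout l k C D -> g C = g D.
Proof.
move=> /andP[lk km]; rewrite -(subKn lk).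
have : (k - l <= k)%N by exact: leq_subr.
elim: (k - l)%N C D => [|e IH] C D ek gadj CD.
  by apply/congr1/eqP; rewrite -(@eqout_eq (k - 0) k) //; lia.
set l' := (k - e.+1)%N in CD gadj *.
have el : (k - e = l'.+1)%N by lia.
have lk' : (l' < k)%N by lia.
have /exists_notin[w wD wC] : (\dim (part D l') < \dim (part D l'.+1))%N.
  by rewrite !part_dim; lia.
have /eqoutP hCD := CD.
have wkC : w \in part C k.
  by rewrite hCD // ?leqnn ?orbT // (subvP (part_le _ _) _ wD) //; lia.
have wlC : w \notin part C l' by rewrite hCD // ?leqnn //; lia.
have step t : (l' <= t < k)%N -> g (ins t w C) = g C.
  move=> ht; have -> : t = (k.-1 - (k.-1 - t))%N by lia.
  have : (k.-1 - t <= k.-1 - l')%N by lia.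
  elim: (k.-1 - t)%N => [|s IHs] hs.
    congr g; apply/chamber_eqP => i hi; rewrite part_ins; last lia.
    have [//|ki] := leqP i (k.-1 - 0).
    by rewrite (subvP (part_le _ _) _ wkC) //; lia.
  rewrite -IHs; last lia.
  have -> : (k.-1 - s = (k.-1 - s.+1).+1)%N by lia.
  set t' := (k.-1 - s.+1)%N.
  apply: (gadj t'.+1); first by rewrite /t'; lia.
  apply/eqoutP => i im /= hi; rewrite !part_ins //.
  by have -> : (i <= t'.+1)%N = (i <= t')%N by lia.
rewrite -(step l'); last lia.
apply: IH => [|j C' D' hj|]; first lia.
  by apply: gadj; lia.
rewrite el eqout_sym -eqout_ins ?wlC //; last lia.
by rewrite eqout_sym CD wD.
Qed.

Lemma card_eqout l k B : (l <= k <= m)%N ->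
  (#|[pred C | eqout l k C B]| * (q - 1) ^ (k - l)
     = \prod_(1 <= i < (k - l).+1) (q ^ i - 1))%N.
Proof.
move=> /andP[lk km]; have q_gt0 : (0 < q)%N by apply/card_gt0P; exists 0.
rewrite -(subKn lk); have : (k - l <= k)%N by exact: leq_subr.
elim: (k - l)%N B => [|e IH] B ek.
  rewrite !subn0 subnn big_geq // expn0 muln1.
  rewrite -[RHS](card1 B); apply: eq_card => C; rewrite !inE.
  by rewrite eqout_eq //; lia.
rewrite subKn // big_nat_recr //=.
set l' := (k - e.+1)%N.
have el : (k - e = l'.+1)%N by lia.
have lk' : (l' < k)%N by lia.
set N := #|_|; set M := (\prod_(_ <= i < _) _)%N.
have key : (N * (q ^ l'.+1 - q ^ l') * (q - 1) ^ e = (q ^ k - q ^ l') * M)%N.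
  have -> : (N * (q ^ l'.+1 - q ^ l')
      = \sum_(C | eqout l' k C B) \sum_(w | (w \in part C l'.+1) && (w \notin part C l')) 1)%N.
    rewrite /N -sum1_card big_distrl /=; apply: eq_bigr => C _.
    have := @card_vspaceD F m (part C l') (part C l'.+1).
    rewrite !part_dim; [|lia|lia].
    rewrite -sum1_card mul1n => <- //; apply: part_le; lia.
  rewrite (exchange_big_dep (fun w => (w \in part B k) && (w \notin part B l'))) /=; last first.
    move=> C w /eqoutP h /andP[wC wC']; rewrite -!h ?leqnn ?orbT //; last lia.
    by rewrite wC' andbT; apply: subvP wC; apply: part_le; lia.
  rewrite big_distrl /=.
  have <- : #|[pred w | (w \in part B k) && (w \notin part B l')]|
      = (q ^ k - q ^ l')%N.
    by rewrite card_vspaceD ?part_dim //; [lia|apply: part_le; lia].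
  rewrite -[X in _ = (X * _)%N]sum1_card big_distrl /=; apply: eq_bigr => w /andP[wk wl].
  have := IH (ins l' w B) (ltnW ek); rewrite subKn ?(ltnW ek) // -/M mul1n => <-.
  congr (_ * _)%N; rewrite -sum1_card; apply: eq_bigl => C.
  rewrite !inE el -eqout_ins ?wk //; last lia.
  case CB : (eqout l' k C B) => //=.
  by move/eqoutP: CB => h; rewrite (h l') ?leqnn ?wl ?andbT //; lia.
have ql : (0 < q ^ l')%N by rewrite expn_gt0 q_gt0.
apply/eqP; rewrite -(eqn_pmul2l ql); apply/eqP.
rewrite [(M * _)%N]mulnC mulnA.
have ek2 : ((q ^ k - q ^ l') = q ^ l' * (q ^ e.+1 - 1))%N.
  by rewrite mulnBr -expnD muln1 /l' subnK.
rewrite mulnA -ek2 -key.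
by rewrite expnS (_ : (q ^ l'.+1 - q ^ l' = q ^ l' * (q - 1)))%N; [ring|rewrite mulnBr muln1 -expnSr].
Qed.

Lemma card_adjacent j B : (0 < j < m)%N -> #|[pred C | eqout j.-1 j.+1 C B]| = q.+1.
Proof.
move=> hj; have q_gt1 : (1 < q)%N by exact: card_finNzRing_gt1.
have := @card_eqout j.-1 j.+1 B; have -> : (j.+1 - j.-1 = 2)%N by lia.
have q2 : (q ^ 2 - 1 = (q - 1) * q.+1)%N by have := subn_sqr q 1; rewrite exp1n addn1.
rewrite big_nat_recr // big_nat1 /= expn1 q2 => h.
have q1 : (0 < (q - 1) ^ 2)%N by rewrite expn_gt0; apply/orP; left; lia.
apply/eqP; rewrite -(eqn_pmul2r q1) h; last lia.
by apply/eqP; rewrite expnS expn1; ring.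
Qed.

End Insertion.

(** * Opposition and its factorization *)

Lemma forall_ordP n (P : pred nat) :
  reflect (forall i, (i <= n)%N -> P i) [forall i : 'I_n.+1, P i].
Proof.
apply: (iffP forallP) => [h i im|h i]; last by rewrite h // -ltnS.
by have := h (inord i); rewrite inordK.
Qed.

Section Relations.
Variables (F : finFieldType) (m : nat).
Local Notation chamber := (chamber F m).
Implicit Types (C D E Q : chamber) (i j k l t : nat) (w : 'rV[F]_m).
Local Notation q := #|F|.

Lemma oppositeP C D : reflect
  (forall i, (i <= m)%N -> (part C i :&: part D (m - i))%VS = 0%VS)
  (opposite C D).
Proof.
apply: (iffP (forall_ordP _ (fun i => part C i :&: part D (m - i) == 0)%VS)).
  by move=> h i im; apply/eqP/h.
by move=> h i im; apply/eqP/h.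
Qed.

Lemma opposite_sym C D : opposite C D = opposite D C.
Proof.
wlog: C D / opposite C D => [h|/oppositeP h].
  by apply/idP/idP => H; [rewrite -(h C D)|rewrite -(h D C)].
apply/esym; rewrite [RHS](introT (oppositeP _ _) h); apply/oppositeP => i im.
by rewrite capvC -[X in part D X](subKn im) h // leq_subr.
Qed.

Definition opposite_off j C D : bool :=
  [forall i : 'I_m.+1, (i != j :> nat) ==> (part C i :&: part D (m - i) == 0)%VS].

Lemma opposite_offP j C D : reflect
  (forall i, (i <= m)%N -> i != j -> (part C i :&: part D (m - i))%VS = 0%VS)
  (opposite_off j C D).
Proof.
apply: (iffP (forall_ordP _
    (fun i => (i != j :> nat) ==> (part C i :&: part D (m - i) == 0)%VS))).
  by move=> h i im ij; apply/eqP; move: (h i im); rewrite ij.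
by move=> h i im; apply/implyP => ij; apply/eqP/h.
Qed.

Lemma opposite_off_sym j C D : (j <= m)%N ->
  opposite_off (m - j) D C = opposite_off j C D.
Proof.
move=> jm; apply/opposite_offP/opposite_offP => h i im ij.
  by rewrite capvC -[X in part C X](subKn im) h ?leq_subr //; lia.
by rewrite capvC -[X in part D X](subKn im) h ?leq_subr //; lia.
Qed.

(* Among the [q + 1] chambers that agree with [C] off [j] exactly one is not
   opposite to [D]: its [j]-th term contains the line [C_(j+1) :&: D_(m-j)]. *)
Lemma card_adjacent_opposite j C D : (0 < j < m)%N ->
  #|[pred E | eqout j.-1 j.+1 C E && opposite E D]| = (q * opposite_off j C D)%N.
Proof.
move=> hj; case: (boolP (opposite_off j C D)) => [/opposite_offP h|]; last first.
  move=> hn; rewrite muln0; apply: eq_card0 => E; rewrite !inE.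
  apply: contraNF hn => /andP[/eqoutP CE /oppositeP ED].
  by apply/opposite_offP => i im ij; rewrite CE ?ED //; lia.
have hC1 : \dim (part C j.+1) = j.+1 by rewrite part_dim; lia.
have hD : \dim (part D (m - j)) = (m - j)%N by rewrite part_dim; lia.
have : (\dim (0 : {vspace 'rV[F]_m}) < \dim (part C j.+1 :&: part D (m - j)))%N.
  rewrite dimv0.
  have := dimv_sum_cap (part C j.+1) (part D (m - j)); rewrite hC1 hD.
  have := dimvS (subvf (part C j.+1 + part D (m - j))%VS).
  rewrite dimvf /dim /= mul1n; lia.
move=> /exists_notin[w]; rewrite memv0 memv_cap => /andP[wC wD] w0.
have wC' : w \notin part C j.-1.
  apply: contra w0 => wC'; rewrite -memv0 -(h j.-1); [|lia|lia].
  by rewrite memv_cap wC' /=; apply: subvP wD; apply: part_le; lia.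
have line x : x \in part C j.+1 -> x \in part D (m - j) -> x \in <[w]>%VS.
  move=> xC xD; set L := (part C j.+1 :&: part D (m - j))%VS.
  have wL : (<[w]> <= L)%VS by rewrite -memvE memv_cap wC.
  rewrite (eqv_dim wL) ?memv_cap ?xC //; apply/eqP; rewrite eqn_leq dimvS //=.
  rewrite dim_vline w0.
  have LI : (L :&: part D (m - j.+1))%VS = 0%VS.
    apply/eqP; rewrite -subv0 -(h j.+1); [|lia|lia].
    by rewrite capvS // capvSl.
  have := dimv_sum_cap L (part D (m - j.+1)); rewrite LI dimv0 addn0 part_dim; last lia.
  have : (L + part D (m - j.+1) <= part D (m - j))%VS.
    by rewrite subv_add capvSr part_le //; lia.
  by move=> /dimvS; rewrite hD; lia.
have bad E : eqout j.-1 j.+1 C E -> opposite E D = (E != ins j.-1 w C).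
  move=> CE; have /eqoutP hE := CE.
  have jj : j = j.-1.+1 by lia.
  have -> : (E == ins j.-1 w C) = (w \in part E j).
    have := @eqout_ins F m j.-1 j.+1 w E C.
    rewrite eqout_sym CE /= -jj => -> //; last lia.
    by rewrite eqout_eq.
  apply/idP/idP => [/oppositeP ED|wE].
    apply: contra w0 => wE; rewrite -memv0 -(ED j); last lia.
    by rewrite memv_cap wE.
  apply/oppositeP => i im; have [->|ij] := eqVneq i j; last first.
    by rewrite -hE ?h //; lia.
  apply/eqP; rewrite -subv0; apply/subvP => x; rewrite memv_cap => /andP[xE xD].
  have xC : x \in part C j.+1.
    by rewrite hE ?(subvP (part_le _ _) _ xE) //; lia.
  have /vlineP[a ex] := line x xC xD; rewrite memv0.
  have [a0|a0] := eqVneq a 0; first by rewrite ex a0 scale0r.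
  by move: wE; rewrite -[w](scalerK a0) -ex memvZ.
have := card_adjacent C hj; rewrite muln1.
rewrite (cardD1 (ins j.-1 w C)) inE.
have -> : eqout j.-1 j.+1 (ins j.-1 w C) C.
  have := @eqout_ins F m j.-1 j.+1 w (ins j.-1 w C) C.
  have -> : j.-1.+1 = j by lia.
  rewrite eqout_refl => e; suff /andP[] : eqout j.-1 j.+1 (ins j.-1 w C) C
    && (w \in part (ins j.-1 w C) j) by [].
  by rewrite e //; lia.
rewrite add1n => -[<-]; apply: eq_card => E; rewrite !inE.
rewrite [eqout _ _ E C]eqout_sym [RHS]andbC.
by case CE : (eqout _ _ C E); rewrite //= bad.
Qed.

(* Opposition in the residue of [C_1, ..., C_l]. *)
Definition opposite_above l C D : bool :=
  [forall i : 'I_m.+1, if (i <= l)%N then part C i == part D i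
     else (part C i :&: part D (m + l - i) == part C l)%VS].

Lemma opposite_aboveP l C D : (l <= m)%N -> reflect
  ((forall i, (i <= l)%N -> part C i = part D i) /\
   (forall i, (l <= i <= m)%N ->
      (part C i :&: part D (m + l - i))%VS = part C l))
  (opposite_above l C D).
Proof.
move=> lm; apply: (iffP (forall_ordP m (fun i => if (i <= l)%N then part C i == part D i
     else (part C i :&: part D (m + l - i) == part C l)%VS))) => [h|[h1 h2] i im].
  split=> i hi; first by have := h i; rewrite hi => H; apply/eqP/H; lia.
  have [il|il] := eqVneq i l.
    by rewrite il addnK partm capvf.
  have il' : (i <= l)%N = false by lia.
  by have := h i; rewrite il' => H; apply/eqP/H; lia.
by case: leqP => hi; apply/eqP; [apply: h1|apply: h2]; lia.
Qed.

Lemma opposite_above0 C D : opposite_above 0 C D = opposite C D.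
Proof.
apply/(opposite_aboveP _ _ (leq0n m))/oppositeP => [[h1 h2] i im|h].
  by have := h2 i; rewrite addn0 part0; apply.
split=> i hi; last by rewrite addn0 part0 h //; lia.
by have -> : i = 0%N; [lia|rewrite !part0].
Qed.

Lemma opposite_above_last C D : (0 < m)%N -> opposite_above m.-1 C D = (C == D).
Proof.
move=> m0; apply/(opposite_aboveP _ _ (leq_pred m))/eqP => [[h1 h2]|->].
  by apply: chamber_eqP => i hi; apply: h1; lia.
split=> // i hi; have [->|->] : i = m.-1 \/ i = m by lia.
  by rewrite addnK partm capvf.
by rewrite addKn partm capfv.
Qed.

(* [C] and [Q] are joined by a gallery of type [m-1, m-2, ..., l+1]. *)
Definition descends l C Q : bool :=
  [forall i : 'I_m.+1, if (l < i < m)%N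
     then (part Q i != part C i) && (part C i <= part Q i.+1)%VS
     else part C i == part Q i].

Lemma descendsP l C Q : reflect
  ((forall i, (l < i < m)%N ->
      part Q i <> part C i /\ (part C i <= part Q i.+1)%VS) /\
   (forall i, (i <= m)%N -> ~~ (l < i < m)%N -> part C i = part Q i))
  (descends l C Q).
Proof.
apply: (iffP (forall_ordP m (fun i => if (l < i < m)%N
     then (part Q i != part C i) && (part C i <= part Q i.+1)%VS
     else part C i == part Q i))) => [h|[h1 h2] i im].
  split=> i.
    move=> hi; have im : (i <= m)%N by lia.
    by have := h i im; rewrite hi => /andP[/eqP].
  by move=> im hi; have := h i im; rewrite (negPf hi) => /eqP.
by case: ifPn => hi; [have [/eqP-> ->] := h1 _ hi|apply/eqP/h2].
Qed.

Lemma descends_last C Q : (0 < m)%N -> descends m.-1 C Q = (C == Q).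
Proof.
move=> m0; apply/descendsP/eqP => [[_ h]|->]; last by split=> // i; lia.
by apply: chamber_eqP => i hi; apply: h; lia.
Qed.

Lemma descends_ins l C Q w : (l < m)%N -> descends l C Q ->
  w \in part Q l.+1 -> w \notin part C l ->
  w \notin part C m.-1 /\ Q = ins l w C.
Proof.
move=> lm /descendsP[h1 h2] wQ wl.
have wQi i : (l < i <= m)%N -> w \in part Q i.
  by move=> hi; apply: subvP wQ; apply: part_le; lia.
have wCi i : (l <= i < m)%N -> w \notin part C i.
  move=> hi; rewrite -(subnKC (n := i) (m := l)); last lia.
  have : (l + (i - l) < m)%N by lia.
  elim: (i - l)%N => [|s IH] hs; first by rewrite addn0.
  rewrite addnS; set t := (l + s)%N in IH hs *.
  have wt : w \notin part C t by apply: IH; lia.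
  have CQ : (part C t <= part Q t.+1)%VS.
    have [tl|tl] := eqVneq t l.
      by rewrite tl h2; [apply: part_le|..]; lia.
    by apply: (h1 t _).2; lia.
  apply/negP => wt1; have [|hne _] := h1 t.+1; first lia.
  apply: hne; rewrite -(addv_line_eq CQ (wQi _ _) wt) ?part_dim //; try lia.
  rewrite (@addv_line_eq _ _ (part C t) (part C t.+1)) ?part_dim //; try lia.
  by apply: part_le; lia.
split; first by apply: wCi; lia.
apply: chamber_eqP => i hi; have [il|li] := leqP i l.
  by rewrite part_ins ?il -?h2 //; lia.
rewrite part_ins_add ?wCi; [|lia..].
apply/esym/addv_line_eq; rewrite ?wQi ?wCi ?part_dim; try lia.
have [il|il] := eqVneq i l.+1.
  by rewrite il /= h2; [apply: part_le|..]; lia.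
have [|_] := h1 i.-1; first lia.
by rewrite prednK //; lia.
Qed.

Lemma ins_descends l C w : (l < m)%N -> w \notin part C m.-1 ->
  descends l C (ins l w C).
Proof.
move=> lm wm.
have wCi i : (i < m)%N -> w \notin part C i.
  by move=> im; apply: contra wm; apply/subvP/part_le; lia.
apply/descendsP; split=> i hi.
  split.
    rewrite part_ins_add ?wCi //; [|lia|lia] => e; have := wCi i; rewrite -e.
    by rewrite (subvP (addvSr _ _) _ (memv_line w)) => /(_ _)/negP; case=> //; lia.
  have [im|im] := eqVneq i.+1 m; first by rewrite im partm subvf.
  by rewrite part_ins_add ?wCi ?addvSl //=; lia.
move=> him; rewrite part_ins //.
have [im|im] := eqVneq i m; first by rewrite im partm memvf orbT.
by have -> : (i <= l)%N by lia.
Qed.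

End Relations.

Section Recursions.
Variables (F : finFieldType) (m : nat).
Local Notation chamber := (chamber F m).
Implicit Types (C D E Q : chamber) (i j k l t : nat) (w : 'rV[F]_m).
Local Notation q := #|F|.

Lemma card_descends_adjacent l C Q : (l.+1 < m)%N ->
  #|[pred E | descends l.+1 C E && (eqout l l.+2 E Q && (E != Q))]|
    = descends l C Q.
Proof.
move=> lm.
case: (boolP (part C l.+1 <= part Q l.+2)%VS) => [CQ|CQ]; last first.
  have -> : descends l C Q = false.
    apply: contraNF CQ => /descendsP[h1 _]; have [|_ ->] := h1 l.+1; lia.
  apply: eq_card0 => E; rewrite !inE; apply: contraNF CQ.
  case/and3P=> /descendsP[_ h2] /eqoutP h3 _; rewrite h2; [|lia|lia].
  by rewrite -h3 ?leqnn ?orbT //; apply: part_le; lia.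
have [||E0 E0E] := @mk_chamber F m (fun i => if (i <= l.+1)%N then part C i else part Q i).
- by move=> i im; case: ifP; rewrite part_dim.
- move=> i im; case: (ltngtP i l.+1) => il; try by apply: part_le; lia.
  by rewrite il.
rewrite (@card_pred_le1 _ _ E0) => [|E /and3P[/descendsP[_ h1] /eqoutP h2 _]]; last first.
  apply: chamber_eqP => i hi; rewrite E0E; last lia.
  by case: leqP => il; [rewrite h1|rewrite h2] => //; lia.
congr nat_of_bool; rewrite inE; apply/and3P/descendsP.
  case=> /descendsP[h1 h2] /eqoutP h3 E0Q; split=> i hi.
    have [il|il] := eqVneq i l.+1.
      rewrite il; split=> // e; case/eqP: E0Q; apply: chamber_eqP => j hj.
      have [->|jl] := eqVneq j l.+1; first by rewrite E0E ?leqnn //; lia.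
      by apply: h3; lia.
    by rewrite -!h3; [apply: h1|..]; lia.
  by move=> hi'; rewrite -h3 ?h2 //; lia.
move=> [h1 h2]; split.
- apply/descendsP; split=> i hi.
    rewrite !E0E; [|lia|lia]; have -> : (i <= l.+1)%N = false by lia.
    by have -> : (i < l.+1)%N = false; [lia|apply: h1; lia].
  move=> hi'; rewrite E0E //; case: leqP => // il; apply: h2; lia.
- apply/eqoutP => i im hi; rewrite E0E //; case: leqP => // il; apply: h2; lia.
- apply/eqP => e; have [|+ _] := h1 l.+1; first lia.
  by rewrite -e E0E ?leqnn //; lia.
Qed.

Lemma card_descends_opposite l C D : (l.+1 < m)%N ->
  #|[pred Q | descends l C Q && opposite_above l.+1 Q D]| = opposite_above l C D.
Proof.
move=> lm; have l1m : (l.+1 <= m)%N by lia.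
have lm' : (l <= m)%N by lia.
have /exists_notin[w wD wD'] : (\dim (part D l) < \dim (part D l.+1))%N.
  by rewrite !part_dim; lia.
case: (boolP (part C l == part D l)) => [/eqP CDl|CDl]; last first.
  have -> : opposite_above l C D = false.
    by apply: contraNF CDl => /(opposite_aboveP _ _ lm')[-> //].
  apply: eq_card0 => Q; rewrite !inE; apply: contraNF CDl.
  by case/andP=> /descendsP[_ h] /(opposite_aboveP _ _ l1m)[h1 _]; rewrite h ?h1 //; lia.
have wC : w \notin part C l by rewrite CDl.
rewrite (@card_pred_le1 _ _ (ins l w C)) => [|Q /andP[dQ oQ]]; last first.
  have [||//] := descends_ins _ dQ _ wC; first lia.
  by have [-> //] := (opposite_aboveP Q D l1m oQ).
congr nat_of_bool; rewrite inE; apply/andP/(opposite_aboveP _ _ lm').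
  case=> dQ /(opposite_aboveP _ _ l1m)[h1 h2]; set Q := ins l w C in dQ h1 h2.
  have wQ : w \in part Q l.+1 by rewrite h1.
  have [wm _] := descends_ins (ltnW lm) dQ wQ wC.
  have /descendsP[d1 d2] := dQ.
  split=> i hi; first by rewrite d2 ?h1 //; lia.
  have [im|im] := eqVneq i m; first by rewrite im addKn partm capfv CDl.
  apply/eqP; rewrite eqEsubv; apply/andP; split; last first.
    rewrite subv_cap; apply/andP; split; first by apply: part_le; lia.
    by rewrite CDl; apply: part_le; lia.
  apply/subvP => x; rewrite memv_cap => /andP[xC xD].
  have xQ : x \in part Q l.+1.
    rewrite -(h2 i.+1); last lia.
    rewrite memv_cap (_ : m + l.+1 - i.+1 = m + l - i)%N ?xD ?andbT; last lia.
    apply: subvP xC; have [il|il] := eqVneq i l; last by apply: (d1 i _).2; lia.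
    by rewrite il d2 ?part_le //; lia.
  move: xQ; rewrite part_ins_add //=; last lia.
  case/memv_addP=> y yC [z /vlineP[a ->] ex].
  have [a0|a0] := eqVneq a 0; first by rewrite ex a0 scale0r addr0.
  have awC : a *: w \in part C i.
    have -> : a *: w = x - y by rewrite ex addrC addKr.
    by rewrite memvB // (subvP (part_le _ _) _ yC) //; lia.
  case/negP: wm; rewrite -[w](scalerK a0) memvZ //.
  by apply: subvP awC; apply: part_le; lia.
case=> h1 h2; have wm : w \notin part C m.-1.
  apply/negP => wm; case/negP: wC; rewrite -(h2 m.-1); last lia.
  by rewrite memv_cap wm (_ : m + l - m.-1 = l.+1)%N //; lia.
have wCi i : (i < m)%N -> w \notin part C i.
  by move=> im; apply: contra wm; apply/subvP/part_le; lia.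
have Ql : part (ins l w C) l.+1 = part D l.+1.
  rewrite part_ins_add //=; last lia.
  by apply: addv_line_eq; rewrite // ?part_dim ?CDl ?part_le //; lia.
split; first by apply: ins_descends; [lia|].
apply/(opposite_aboveP _ _ l1m); split=> i hi.
  have [->//|il] := eqVneq i l.+1.
  by rewrite part_ins ?h1; [case: ifP => //|..]; lia.
have [im|im] := eqVneq i m; first by rewrite im addKn partm capfv Ql.
rewrite Ql !part_ins_add ?wCi /=; try lia.
have wDi : (<[w]> <= part D (m + l.+1 - i))%VS.
  by rewrite -memvE (subvP (part_le _ _) _ wD) //; lia.
rewrite capvC -vspace_modr // capvC.
rewrite (_ : m + l.+1 - i = m + l - i.-1)%N; last lia.
by rewrite h2; [rewrite -Ql part_ins_add //=|]; lia.
Qed.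

Lemma card_descends_hyperplane Q (H : {vspace 'rV[F]_m}) :
  (1 < m)%N -> \dim H = m.-1 ->
  #|[pred C | descends 0 C Q && (part C m.-1 == H)]| = ~~ (part Q 1 <= H)%VS.
Proof.
move=> m1 dH; case: (boolP (part Q 1 <= H)%VS) => [QH|QH] /=.
  apply: eq_card0 => C; rewrite !inE; apply/negP => /andP[dC /eqP CH].
  have /exists_notin[w wQ w0] : (\dim (0 : {vspace 'rV[F]_m}) < \dim (part Q 1))%N.
    by rewrite dimv0 part_dim; lia.
  have [||wm _] := descends_ins _ dC wQ; [lia|by rewrite part0|].
  by case/negP: wm; rewrite CH (subvP QH).
have QHi i : (i < m)%N -> \dim (H :&: part Q i.+1) = i.
  move=> im; have := dimv_sum_cap H (part Q i.+1); rewrite dH part_dim //.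
  have dS : (m.-1 < \dim (H + part Q i.+1))%N.
    rewrite ltnNge; apply: contra QH => le.
    have -> : H = (H + part Q i.+1)%VS.
      apply: eqv_dim (addvSl _ _) _; apply/eqP.
      by rewrite eqn_leq dimvS ?addvSl //= dH.
    by apply: subv_trans (addvSr _ _); apply: part_le; lia.
  have := dimvS (subvf (H + part Q i.+1)%VS); rewrite dimvf /dim /= mul1n; lia.
have [||C0 C0E] := @mk_chamber F m
    (fun i => if (i < m)%N then (H :&: part Q i.+1)%VS else fullv).
- move=> i im; case: ltnP => // mi; first exact: QHi.
  by rewrite dimvf /dim /= mul1n; lia.
- move=> i im; rewrite im; case: ltnP => im1; last exact: subvf.
  by apply: capvS => //; apply: part_le; lia.
rewrite (@card_pred_le1 _ _ C0) => [|C /andP[/descendsP[h1 _] /eqP CH]]; last first.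
  apply: chamber_eqP => i hi; rewrite C0E; last lia.
  have -> : (i < m)%N by lia.
  apply: eqv_dim; last by rewrite part_dim ?QHi //; lia.
  by rewrite subv_cap -CH part_le ?(h1 i _).2 //; lia.
apply/eqP; rewrite eqb1 inE; apply/andP; split; last first.
  by rewrite C0E ?leq_pred // prednK ?leqnn ?partm ?capvf //; lia.
apply/descendsP; split=> i hi.
  rewrite C0E; last lia.
  have -> : (i < m)%N by lia.
  split; last exact: capvSr.
  move=> e; case/negP: QH; apply: (@subv_trans _ _ (part Q i)).
    by apply: part_le; lia.
  by rewrite e capvSl.
move=> hi'; have [->|->] : i = 0%N \/ i = m by lia.
  by rewrite !part0.
by rewrite !partm.
Qed.

Lemma card_descends_off C (H : {vspace 'rV[F]_m}) : (1 < m)%N -> \dim H = m.-1 ->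
  (#|[pred Q | descends 0 C Q && ~~ (part Q 1 <= H)%VS]| + q ^ m.-2
     = q ^ m.-1 + (part C m.-1 == H) * q ^ m.-2)%N.
Proof.
move=> m1 dH; have q_gt1 : (1 < q)%N by exact: card_finNzRing_gt1.
set N := #|_|; set K := part C m.-1.
have dK : \dim K = m.-1 by rewrite part_dim //; lia.
have key : (N * (q - 1) = #|[pred w | (w \notin K) && (w \notin H)]|)%N.
  have -> : (N * (q - 1) = \sum_(Q | descends 0 C Q && ~~ (part Q 1 <= H)%VS)
      \sum_(w | (w \in part Q 1) && (w \notin part Q 0)) 1)%N.
    rewrite /N -sum1_card big_distrl /=; apply: eq_bigr => Q _.
    have := @card_vspaceD F m (part Q 0) (part Q 1).
    rewrite !part_dim; [|lia|lia].
    rewrite expn1 expn0 -sum1_card mul1n => <- //; apply: part_le; lia.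
  rewrite (exchange_big_dep (fun w => (w \notin K) && (w \notin H))) /=.
    rewrite -[RHS]sum1_card; apply: eq_bigr => w /andP[wK wH].
    have w0 : w \notin part C 0 by apply: contra wK; apply/subvP/part_le; lia.
    have dw := ins_descends (ltnW m1) wK.
    have ww : w \in part (ins 0 w C) 1.
      by rewrite part_ins_add //= ?(subvP (addvSr _ _) _ (memv_line w)) //; lia.
    rewrite sum1_card (@card_pred_le1 _ _ (ins 0 w C)); last first.
      move=> Q /and3P[/andP[dQ _] wQ _].
      by have [] := descends_ins (ltnW m1) dQ wQ w0.
    rewrite /= dw ww (part0 (ins 0 w C)) -(part0 C) w0 !andbT /=.
    by apply/eqP; rewrite eqb1; apply: contra wH => /subvP; apply.
  move=> Q w /andP[dQ QH] /andP[wQ w0].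
  have wC : w \notin part C 0 by rewrite part0 -(part0 Q).
  have [-> _] := descends_ins (ltnW m1) dQ wQ wC.
  apply: contra QH => wH.
  rewrite -(@addv_line_eq _ _ (part Q 0) (part Q 1) w) ?part_dim ?part_le //; try lia.
  by rewrite part0 add0v -memvE.
have q1 : (0 < q - 1)%N by lia.
have em : (m.-1 = m.-2.+1)%N by lia.
have cK : (#|[pred w | w \in K]| = q ^ m.-1)%N by rewrite card_vspace_rV dK.
have cKC : (#|[pred w | w \notin K]| = q ^ m - q ^ m.-1)%N.
  have := @card_vspaceD F m K fullv (subvf _).
  rewrite dK dimvf /dim /= mul1n => <-.
  by apply: eq_card => w; rewrite !inE memvf.
have qm : (q ^ m = q ^ m.-1 * q)%N by rewrite -expnSr prednK //; lia.
have qm1 : (q ^ m.-1 = q ^ m.-2 * q)%N by rewrite -expnSr -em.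
have qpos : (0 < q ^ m.-2)%N by rewrite expn_gt0 (ltnW q_gt1).
case: eqP => [KH|KH].
  move: key; rewrite -KH (eq_card (B := [pred w | w \notin K])); last first.
    by move=> w; rewrite !inE andbb.
  have -> : (#|[pred w | w \notin K]| = q ^ m.-1 * (q - 1))%N.
    by rewrite cKC mulnBr muln1 -qm.
  move/eqP; rewrite eqn_pmul2r // => /eqP ->.
  by rewrite mul1n.
rewrite mul0n addn0.
have cKH : (#|[pred w | (w \in H) && (w \notin (K :&: H)%VS)]| = q ^ m.-1 - q ^ m.-2)%N.
  rewrite card_vspaceD ?capvSr // dH; congr (_ - _ ^ _)%N.
  have := dimv_sum_cap K H; rewrite dK dH.
  have := dimvS (subvf (K + H)%VS); rewrite dimvf /dim /= mul1n.
  suff : (m.-1 < \dim (K + H))%N by lia.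
  rewrite ltnNge; apply/negP => le; case: KH.
  have eK : K = (K + H)%VS.
    by apply: eqv_dim (addvSl _ _) _; apply/eqP; rewrite eqn_leq dimvS ?addvSl //= dK.
  have eH : H = (K + H)%VS.
    by apply: eqv_dim (addvSr _ _) _; apply/eqP; rewrite eqn_leq dimvS ?addvSr //= dH.
  by rewrite eK -eH.
have := cardID [pred w | w \in H] [pred w | w \notin K]; rewrite cKC.
rewrite [X in (X + _)%N](_ : _ = #|[pred w | (w \in H) && (w \notin (K :&: H)%VS)]|); last first.
  apply: eq_card => w; rewrite !inE memv_cap; case: (w \in K); case: (w \in H) => //.
rewrite cKH [X in (_ + X)%N](_ : _ = #|[pred w | (w \notin K) && (w \notin H)]|); last first.
  by apply: eq_card => w; rewrite !inE andbC.
rewrite -key qm qm1 => e.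
apply/eqP; rewrite -(eqn_pmul2r q1); apply/eqP; move: e.
move: (q ^ m.-2)%N qpos => x; nia.
Qed.

End Recursions.

(** * The opposition matrix *)

HB.instance Definition _ (R : pzSemiRingType) n :=
  Monoid.isLaw.Build 'M[R]_n 1%:M (@mulmx R n n n)
    (@mulmxA R n n n n) (@mul1mx R n n) (@mulmx1 R n n).

Lemma sum_indicator (R : pzSemiRingType) (T : finType) (P Q : pred T) :
  \sum_(x | P x) (Q x)%:R = #|[pred x | P x && Q x]|%:R :> R.
Proof.
rewrite -sum1_card natr_sum [RHS]big_mkcondr.
by apply: eq_bigr => x _; case: (Q x).
Qed.

Section Operators.
Variables (R : realType) (F : finFieldType) (m : nat).
Local Notation chamber := (chamber F m).
Local Notation p := #|{: chamber}|.
Local Notation q := (#|F|%:R : R).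
Implicit Types (C D E : chamber) (i j k l : nat) (r s t : rel chamber).

Definition relmx r : 'M[R]_p := \matrix_(i, j) (r (enum_val i) (enum_val j))%:R.

Lemma eq_relmx r s : r =2 s -> relmx r = relmx s.
Proof. by move=> rs; apply/matrixP => i j; rewrite !mxE rs. Qed.

Lemma relmx_eq : relmx (fun C D => C == D) = 1%:M.
Proof. by apply/matrixP => i j; rewrite !mxE (inj_eq enum_val_inj). Qed.

Lemma relmx_tr r : (forall C D, r C D = r D C) -> (relmx r)^T = relmx r.
Proof. by move=> rC; apply/matrixP => i j; rewrite !mxE rC. Qed.

Lemma relmxM r s t (c : nat) :
  (forall C D, #|[pred E | r C E && s E D]| = (c * t C D)%N) ->
  relmx r *m relmx s = c%:R *: relmx t.
Proof.
move=> rst; apply/matrixP => i j; rewrite !mxE -natrM -rst -[X in _ = X%:R]sum1_card natr_sum.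
rewrite (reindex_onto enum_rank enum_val) /=; last by move=> k _; rewrite enum_valK.
rewrite [RHS]big_mkcond /=; apply: eq_big => [E|E _]; first by rewrite enum_rankK eqxx.
by rewrite !mxE enum_rankK -natrM mulnb inE; case: (_ && _).
Qed.

Lemma mulmx_relmx (u : 'rV[R]_p) r D :
  (u *m relmx r) 0 (enum_rank D) = \sum_(C | r C D) u 0 (enum_rank C).
Proof.
rewrite mxE (reindex_onto enum_rank enum_val) /=; last by move=> k _; rewrite enum_valK.
rewrite [RHS]big_mkcond /=; apply: eq_big => [E|E _]; first by rewrite enum_rankK eqxx.
by rewrite !mxE !enum_rankK; case: (r E D); rewrite ?mulr1 ?mulr0.
Qed.

Definition adjmx j := relmx (eqout j.-1 j.+1).
Definition descmx l := relmx (descends l).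
Definition oppmx l := relmx (@opposite_above F m l).

Lemma oppmx0 : oppmx 0 = opp_adjmx F m R.
Proof. by apply: eq_relmx => C D; rewrite opposite_above0. Qed.

Lemma adjmx_sqr j : (0 < j < m)%N -> adjmx j *m adjmx j = (q + 1) *: adjmx j.
Proof.
move=> hj; rewrite natr1; apply: relmxM => C D.
case CD : (eqout j.-1 j.+1 C D).
  rewrite muln1 -(card_adjacent C hj); apply: eq_card => E; rewrite !inE.
  rewrite [in RHS]eqout_sym; apply: andb_idr => CE.
  by apply: eqout_trans CD; rewrite eqout_sym.
rewrite muln0; apply: eq_card0 => E; rewrite !inE; apply: contraFF CD.
by case/andP; apply: eqout_trans.
Qed.

Lemma adjmx_opp i : (0 < i < m)%N ->
  adjmx i *m oppmx 0 = oppmx 0 *m adjmx (m - i).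
Proof.
move=> hi; rewrite /oppmx (eq_relmx (@opposite_above0 F m)).
rewrite (relmxM (t := opposite_off i) (c := #|F|)); last first.
  by move=> C D; apply: card_adjacent_opposite.
apply/esym/relmxM => C D; rewrite -opposite_off_sym; last lia.
rewrite -card_adjacent_opposite; last lia.
by apply: eq_card => E; rewrite !inE eqout_sym andbC opposite_sym.
Qed.

Lemma descmx_last : (0 < m)%N -> descmx m.-1 = 1%:M.
Proof.
by move=> m0; rewrite -relmx_eq; apply: eq_relmx => C D; rewrite descends_last.
Qed.

Lemma oppmx_last : (0 < m)%N -> oppmx m.-1 = 1%:M.
Proof.
by move=> m0; rewrite -relmx_eq; apply: eq_relmx => C D; rewrite opposite_above_last.
Qed.

Lemma descmx_rec l : (l.+1 < m)%N ->
  descmx l = descmx l.+1 *m (adjmx l.+1 - 1%:M).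
Proof.
move=> lm.
have -> : adjmx l.+1 - 1%:M = relmx (fun C D => eqout l l.+2 C D && (C != D)).
  rewrite -relmx_eq; apply/matrixP => i j; rewrite !mxE /=.
  by have [->|_] := eqVneq (enum_val i) (enum_val j);
    rewrite ?eqout_refl ?subrr ?subr0 ?andbT.
rewrite (relmxM (t := descends l) (c := 1)) ?scale1r // => C D.
by rewrite mul1n card_descends_adjacent.
Qed.

Lemma oppmx_rec l : (l.+1 < m)%N -> oppmx l = descmx l *m oppmx l.+1.
Proof.
move=> lm; rewrite (relmxM (t := opposite_above l) (c := 1)) ?scale1r // => C D.
by rewrite mul1n card_descends_opposite.
Qed.

Lemma adjmx_tr j : (adjmx j)^T = adjmx j.
Proof. by apply: relmx_tr => C D; rewrite eqout_sym. Qed.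

Lemma oppmx0_tr : (oppmx 0)^T = oppmx 0.
Proof. by apply: relmx_tr => C D; rewrite !opposite_above0 opposite_sym. Qed.

Local Notation T j := (adjmx j - 1%:M).

Lemma descmx_tr l : (l < m)%N ->
  (descmx l)^T = \big[mulmx/1%:M]_(l.+1 <= j < m) T j.
Proof.
move=> lm; have m0 : (0 < m)%N by lia.
move: l lm; apply: word_ind => [|l lm IH].
  by rewrite descmx_last // trmx1 big_geq //; lia.
by rewrite descmx_rec // trmx_mul IH raddfB /= adjmx_tr trmx1 [RHS]big_ltn.
Qed.

Lemma descmx_opp l : (l < m)%N ->
  descmx l *m oppmx 0 = oppmx 0 *m \big[mulmx/1%:M]_(1 <= j < m - l) T j.
Proof.
move=> lm; have m0 : (0 < m)%N by lia.
move: l lm; apply: word_ind => [|l lm IH].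
  by rewrite descmx_last // mul1mx big_geq ?mulmx1 //; lia.
rewrite descmx_rec // -mulmxA mulmxBl mul1mx adjmx_opp; last lia.
rewrite -{2}[oppmx 0]mulmx1 -mulmxBr mulmxA IH -mulmxA.
rewrite (_ : m - l = (m - l.+1).+1)%N; last lia.
by rewrite big_nat_recr //=; lia.
Qed.

Lemma descmx0_opp : (0 < m)%N ->
  descmx 0 *m oppmx 0 = oppmx 0 *m (descmx 0)^T.
Proof. by move=> m0; rewrite descmx_opp // descmx_tr // subn0. Qed.

Lemma fix_adjmx j (u : 'rV[R]_p) C D : u *m adjmx j = (q + 1) *: u ->
  eqout j.-1 j.+1 C D -> u 0 (enum_rank C) = u 0 (enum_rank D).
Proof.
move=> uj CD; have q1 : q + 1 != 0 by rewrite natr1 pnatr_eq0.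
apply: (mulfI q1); have e E : (q + 1) * u 0 (enum_rank E)
    = \sum_(C | eqout j.-1 j.+1 C E) u 0 (enum_rank C).
  by rewrite -mulmx_relmx -/(adjmx j) uj mxE.
rewrite !e; apply: eq_bigl => E; apply/idP/idP => h; apply: eqout_trans h _ => //.
by rewrite eqout_sym.
Qed.

Lemma fix_adjmxP j (u : 'rV[R]_p) : (0 < j < m)%N ->
  (forall C D, eqout j.-1 j.+1 C D -> u 0 (enum_rank C) = u 0 (enum_rank D)) ->
  u *m adjmx j = (q + 1) *: u.
Proof.
move=> hj h; apply/rowP => i; rewrite -(enum_valK i) mulmx_relmx mxE.
rewrite (eq_bigr (fun=> u 0 (enum_rank (enum_val i)))) => [|C CD]; last exact: h.
by rewrite sumr_const (card_adjacent _ hj) natr1 mulr_natl.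
Qed.

Lemma fix_words (u : 'rV[R]_p) l : (l < m)%N ->
  (forall j, (l < j < m)%N -> u *m adjmx j = (q + 1) *: u) ->
  u *m descmx l = q ^+ (m.-1 - l) *: u /\ u *m oppmx l = q ^+ 'C(m - l, 2) *: u.
Proof.
move=> lm; have m0 : (0 < m)%N by lia.
move: l lm; apply: word_ind => [|l lm IH] h.
  rewrite descmx_last // oppmx_last // subnn mulmx1 scale1r.
  by rewrite (_ : m - m.-1 = 1)%N ?scale1r //; lia.
have [|IHY IHB] := IH; first by move=> j hj; apply: h; lia.
have hY : u *m descmx l = q ^+ (m.-1 - l) *: u.
  rewrite descmx_rec // mulmxA IHY -scalemxAl mulmxBr mulmx1 h; last lia.
  rewrite scalerDl scale1r addrK scalerA -exprSr.
  by rewrite (_ : m.-1 - l = (m.-1 - l.+1).+1)%N //; lia.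
split=> //; rewrite oppmx_rec // mulmxA hY -scalemxAl IHB scalerA -exprD.
rewrite (_ : m - l = (m - l.+1).+1)%N ?binS ?bin1; last lia.
by rewrite addnC (_ : m.-1 - l = m - l.+1)%N //; lia.
Qed.

Lemma ones_adjmx j : (0 < j < m)%N ->
  const_mx 1 *m adjmx j = (q + 1) *: (const_mx 1 : 'rV[R]_p).
Proof. by move=> hj; apply: fix_adjmxP => // C D _; rewrite !mxE. Qed.

(* The difference [k] of the indicators of two hyperplanes satisfies
   [k A^2 = q^(m(m-2)) k], so that [k A - q^e k] is an eigenvector. *)
Lemma exists_eigenvector e : (1 < m)%N -> (2 * e = m * (m - 2))%N ->
  exists2 u : 'rV[R]_p, u != 0 & u *m oppmx 0 = - q ^+ e *: u.
Proof.
move=> m1 he; have m0 : (0 < m)%N by lia.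
pose C0 := chamber_exists F m; pose H0 := part C0 m.-1.
have [C1 CC1 C10] : exists2 C1, eqout m.-1.-1 m.-1.+1 C1 C0 & C1 != C0.
  have hm : (0 < m.-1 < m)%N by lia.
  have := card_adjacent C0 hm.
  rewrite (cardD1 C0) inE eqout_refl add1n => -[] hc.
  have /card_gt0P[C1] : (0 < #|[predD1 [pred C | eqout m.-1.-1 m.-1.+1 C C0] & C0]|)%N.
    by rewrite hc; apply/card_gt0P; exists 0.
  by rewrite !inE => /andP[h1 h2]; exists C1.
pose H1 := part C1 m.-1.
have H01 : H0 != H1.
  apply: contraNneq C10 => h; apply/eqP/chamber_eqP => i hi.
  have [->|im] := eqVneq i m.-1; first exact/esym.
  by move/eqoutP: CC1; apply; lia.
have dH0 : \dim H0 = m.-1 by rewrite part_dim // leq_pred.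
have dH1 : \dim H1 = m.-1 by rewrite part_dim // leq_pred.
pose kf C : R := (part C m.-1 == H0)%:R - (part C m.-1 == H1)%:R.
pose k : 'rV[R]_p := \row_i kf (enum_val i).
pose gf C : R := (~~ (part C 1 <= H0)%VS)%:R - (~~ (part C 1 <= H1)%VS)%:R.
have kY : k *m descmx 0 = \row_i gf (enum_val i).
  apply/rowP => i; rewrite -(enum_valK i) mulmx_relmx mxE enum_rankK /gf.
  rewrite -!card_descends_hyperplane // -!sum_indicator -sumrB.
  by apply: eq_bigr => C _; rewrite mxE enum_rankK.
set g := (X in _ = X) in kY.
have gfix j : (1 < j < m)%N -> g *m adjmx j = (q + 1) *: g.
  move=> hj; apply: fix_adjmxP => [|C D /eqoutP CD]; first lia.
  by rewrite !mxE !enum_rankK /gf CD //; lia.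
have kA : k *m oppmx 0 = q ^+ 'C(m.-1, 2) *: g.
  rewrite oppmx_rec // mulmxA kY (fix_words _ gfix).2 //.
  by rewrite subn1.
have gYt : g *m (descmx 0)^T = q ^+ m.-2 *: k.
  apply/rowP => i; rewrite -(enum_valK i) !mxE.
  rewrite (reindex_onto enum_rank enum_val) /=; last by move=> j _; rewrite enum_valK.
  set C := enum_val i.
  have cnt H : \dim H = m.-1 ->
      (#|[pred Q | descends 0 C Q && ~~ (part Q 1 <= H)%VS]|)%:R + q ^+ m.-2
      = q ^+ m.-1 + (part C m.-1 == H)%:R * q ^+ m.-2.
    move=> dH; have := congr1 (fun x => x%:R : R) (card_descends_off C m1 dH).
    by rewrite !natrD natrM !natrX.
  transitivity (\sum_(Q | descends 0 C Q) gf Q).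
    rewrite [RHS]big_mkcond /=; apply: eq_big => [Q|Q _]; first by rewrite enum_rankK eqxx.
    by rewrite !mxE !enum_rankK; case: descends; rewrite ?mulr1 ?mulr0.
  have -> : \sum_(Q | descends 0 C Q) gf Q
      = (#|[pred Q | descends 0 C Q && ~~ (part Q 1 <= H0)%VS]|)%:R
        - (#|[pred Q | descends 0 C Q && ~~ (part Q 1 <= H1)%VS]|)%:R.
    by rewrite -!sum_indicator -sumrB.
  have e0 := cnt _ dH0; have e1 := cnt _ dH1.
  rewrite enum_rankK -/C /kf; move: e0 e1; set a := _%:R; set b := _%:R.
  move=> e0 e1; lra.
have kAA : k *m oppmx 0 *m oppmx 0 = q ^+ (e + e) *: k.
  rewrite kA -scalemxAl -kY -mulmxA descmx0_opp // mulmxA kA -scalemxAl gYt.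
  rewrite !scalerA -!exprD; congr (_ ^+ _ *: _).
  have := mul_bin_diag m.-1 1; rewrite bin1; nia.
exists (k *m oppmx 0 - q ^+ e *: k); last first.
  rewrite mulmxBl kAA -scalemxAl exprD -scalerA -scalerBr scaleNr -scalerN opprB.
  by [].
apply/eqP; rewrite kA => /rowP/(_ (enum_rank C0)); rewrite !mxE enum_rankK.
have -> : gf C0 = - (~~ (part C0 1 <= H1)%VS)%:R.
  by rewrite /gf part_le ?sub0r //; lia.
have -> : kf C0 = 1 by rewrite /kf eqxx (negPf H01) subr0.
rewrite mulr1 mulrN => /eqP; rewrite -opprD oppr_eq0 paddr_eq0; last 2 first.
- by rewrite mulr_ge0 ?exprn_ge0 ?ler0n.
- by rewrite exprn_ge0 ?ler0n.
case/andP=> _; rewrite expf_eq0 pnatr_eq0 => /andP[_ /eqP q0].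
by have := card_finNzRing_gt1 F; rewrite q0.
Qed.

End Operators.

(** * Eigenvectors for negative eigenvalues *)

Section NegativeSpectrum.
Variables (R : realType) (F : finFieldType) (m : nat).
Local Notation chamber := (chamber F m).
Local Notation p := #|{: chamber}|.
Local Notation q := (#|F|%:R : R).
Local Notation T := (@adjmx R F m).
Local Notation A := (@oppmx R F m 0).
Local Notation one := (const_mx 1 : 'cV[R]_p).
Hypothesis m_gt1 : (1 < m)%N.

Let m_gt0 : (0 < m)%N. Proof. exact: ltnW. Qed.
Let q_gt1 : 1 < q. Proof. by rewrite ltr1n card_finNzRing_gt1. Qed.

Lemma adjmx_one j : (0 < j < m)%N -> T j *m one = (q + 1) *: one.
Proof.
move=> hj; rewrite -[LHS]trmxK trmx_mul adjmx_tr trmx_const ones_adjmx //.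
by rewrite linearZ /= trmx_const.
Qed.

Lemma oppmx_one : A *m one = q ^+ 'C(m, 2) *: one.
Proof.
have [] := @fix_words R F m (const_mx 1) 0 m_gt0.
  by move=> j hj; apply: ones_adjmx.
move=> _ h; rewrite -[LHS]trmxK trmx_mul oppmx0_tr trmx_const h subn0.
by rewrite linearZ /= trmx_const.
Qed.

Variables (b : R) (b_lt0 : b < 0).

Definition negspace : 'M[R]_p := (eigenspace (A *m A) (b ^+ 2) :&: kermx one)%MS.

Lemma eigenspace_sub_negspace : (eigenspace A b <= negspace)%MS.
Proof.
have /eigenspaceP e := submx_refl (eigenspace A b).
rewrite sub_capmx; apply/andP; split.
  by apply/eigenspaceP; rewrite mulmxA e -scalemxAl e scalerA -expr2.
apply/sub_kermxP; set X := eigenspace A b in e *.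
have h : b *: (X *m one) = q ^+ 'C(m, 2) *: (X *m one).
  by rewrite scalemxAl -e -mulmxA oppmx_one scalemxAr.
have : (q ^+ 'C(m, 2) - b) *: (X *m one) = 0 by rewrite scalerBl -h subrr.
move/eqP; rewrite scalemx_eq0 => /orP[|/eqP//].
have : 0 < q ^+ 'C(m, 2) by rewrite exprn_gt0 // (lt_trans ltr01).
by rewrite subr_eq0 => c_gt0 /eqP cb; move: (lt_trans b_lt0 c_gt0); rewrite cb ltxx.
Qed.

Lemma negspace_stable j : (0 < j < m)%N -> stablemx negspace (T j).
Proof.
move=> hj; have /eigenspaceP e := capmxSl (eigenspace (A *m A) (b ^+ 2)) (kermx one).
have /sub_kermxP k := capmxSr (eigenspace (A *m A) (b ^+ 2)) (kermx one).
rewrite sub_capmx; apply/andP; split; last first.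
  by apply/sub_kermxP; rewrite -mulmxA adjmx_one // -scalemxAr k scaler0.
apply/eigenspaceP; rewrite -mulmxA (mulmxA (T j)) adjmx_opp // -mulmxA adjmx_opp; last lia.
have -> : (m - (m - j) = j)%N by lia.
by rewrite (mulmxA A A) mulmxA e -scalemxAl.
Qed.

Lemma negspace_sqr : negspace *m (A *m A) = b ^+ 2 *: negspace.
Proof. exact/eigenspaceP/capmxSl. Qed.

Lemma negspace_fixed :
  (negspace :&: \bigcap_(i <- index_iota 1 m) eigenspace (T i) (q + 1))%MS = 0.
Proof.
set X := (_ :&: _)%MS.
apply/row_matrixP => i; rewrite row0; set u := row i X.
have uX : (u <= X)%MS by exact: row_sub.
have /sub_kermxP u1 : (u <= kermx one)%MS.
  by apply: submx_trans uX _; apply: submx_trans (capmxSl _ _) (capmxSr _ _).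
have uT j : (0 < j < m)%N -> u *m T j = (q + 1) *: u.
  move=> hj; apply/eigenspaceP; apply: submx_trans uX _.
  apply: submx_trans (capmxSr _ _) _.
  have : j \in index_iota 1 m by rewrite mem_index_iota.
  elim: (index_iota 1 m) => // a r IH; rewrite inE big_cons.
  by case/orP=> [/eqP->|/IH]; [exact: capmxSl|apply: submx_trans (capmxSr _ _)].
have cst C D : u 0 (enum_rank C) = u 0 (enum_rank D).
  apply: (@eqout_connect F m _ (fun C => u 0 (enum_rank C)) 0 m).
  - by rewrite leqnn.
  - by move=> j C' D' hj; apply: fix_adjmx (uT _ hj).
  by apply/eqoutP => k km /orP[|]; [rewrite leqn0 => /eqP->; rewrite !part0
    |move=> mk; have -> : k = m; [lia|rewrite !partm]].
have [C0] : exists C0 : chamber, True by exists (chamber_exists F m).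
move=> _; have ue : u = u 0 (enum_rank C0) *: const_mx 1.
  by apply/rowP => k; rewrite !mxE -(enum_valK k) mulr1; have := cst (enum_val k) C0; rewrite !mxE.
have : u 0 (enum_rank C0) * p%:R = 0.
  have := congr1 (fun M : 'M_1 => M 0 0) u1.
  rewrite {1}ue -scalemxAl !mxE => <-; congr (_ * _).
  by under eq_bigr do rewrite !mxE mulr1; rewrite sumr_const card_ord.
move/eqP; rewrite mulf_eq0 pnatr_eq0 => /orP[/eqP u0|].
  by rewrite ue u0 scale0r.
by move/eqP/card0_eq/(_ C0).
Qed.

Let b2_neq0 : b ^+ 2 != 0. Proof. by rewrite expf_neq0 // lt_eqF. Qed.

Lemma negative_eigenvalue_bound : eigenvalue A b -> b ^+ 2 <= q ^+ (m * (m - 2)).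
Proof.
move=> hb; apply: (lam_bound m_gt0 q_gt1 (@adjmx_sqr R F m) (@adjmx_opp R F m)
  (descmx_last _ _ m_gt0) (@descmx_rec R F m) (oppmx_last _ _ m_gt0)
  (@oppmx_rec R F m) negspace_stable b2_neq0 negspace_sqr negspace_fixed) => //.
  rewrite lt0n mxrank_eq0; apply: contraNneq hb => h.
  by rewrite -submx0 -h eigenspace_sub_negspace.
exact: sqr_ge0.
Qed.

Lemma fixed_outside (u : 'rV[R]_p) l k C D : (l <= k <= m)%N ->
  (u <= \bigcap_(i <- index_iota l.+1 k) eigenspace (T i) (q + 1))%MS ->
  eqout l k C D -> u 0 (enum_rank C) = u 0 (enum_rank D).
Proof.
move=> lk hu; apply: (@eqout_connect F m _ (fun C => u 0 (enum_rank C))) => //.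
move=> j C' D' hj; apply: fix_adjmx; apply/eigenspaceP; apply: submx_trans hu _.
have : j \in index_iota l.+1 k by rewrite mem_index_iota.
elim: (index_iota l.+1 k) => // a r IH; rewrite inE big_cons.
by case/orP=> [/eqP->|/IH]; [exact: capmxSl|apply: submx_trans (capmxSr _ _)].
Qed.

Lemma extremal_eigenvector n (e : 'rV[R]_p) : m = (2 * n)%N ->
  b ^+ 2 = q ^+ (m * (m - 2)) -> (e <= eigenspace A b)%MS ->
  exists u v : 'rV[R]_p, [/\ e = u + v,
    forall C D, eqout n m C D -> u 0 (enum_rank C) = u 0 (enum_rank D) &
    forall C D, eqout 0 n C D -> v 0 (enum_rank C) = v 0 (enum_rank D)].
Proof.
move=> mn hb he; have n_gt0 : (0 < n)%N by lia.
have hs := extremal_split m_gt0 q_gt1 (@adjmx_sqr R F m) (@adjmx_opp R F m)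
  (descmx_last _ _ m_gt0) (@descmx_rec R F m) (oppmx_last _ _ m_gt0)
  (@oppmx_rec R F m) negspace_stable b2_neq0 negspace_sqr negspace_fixed mn n_gt0 hb.
have /sub_addsmxP[[X Y] /= eXY] := submx_trans he (submx_trans eigenspace_sub_negspace hs).
eexists; eexists; split; first exact: eXY.
  move=> C D; apply: fixed_outside; first lia.
  by apply: mulmx_sub; apply: capmxSr.
move=> C D; apply: fixed_outside; first lia.
by apply: mulmx_sub; apply: capmxSr.
Qed.

End NegativeSpectrum.

(** * The unitary function *)

Section Polarity.
Variables (K : fieldType) (eps : bool) (theta : {rmorphism K -> K}).
Variables (vT : vectType K) (f : {hermitian vT for eps & theta}).
Hypothesis fnd : nondegenerate f.
Implicit Types U V : {vspace vT}.

Lemma orthov_addv U V : orthov f (U + V) = (orthov f U :&: orthov f V)%VS.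
Proof.
apply/eqP; rewrite eqEsubv subv_cap -orthovD subvv /= orthovD.
by rewrite capvSl capvSr.
Qed.

Lemma orthov_anti U V : (U <= V)%VS -> (orthov f V <= orthov f U)%VS.
Proof. by move=> /addv_idPr <-; rewrite orthov_addv capvSl. Qed.

Lemma leq_dim_orthov U : (\dim {: vT} <= \dim (orthov f U) + \dim U)%N.
Proof.
rewrite -{1}(span_basis (vbasisP U)) -[X in (_ + X)%N](size_tuple (vbasis U)).
elim: (tval (vbasis U)) => [|x s IH]; first by rewrite span_nil orthov0 addn0.
rewrite span_cons orthov_addv capvC /=.
apply: leq_trans IH _; rewrite addnS -addSn leq_add2r.
by apply: leq_trans (leqSpred _) _; rewrite ltnS leq_dim_orthov1.
Qed.

Lemma dim_orthov U : (\dim (orthov f U) + \dim U)%N = \dim {: vT}.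
Proof.
have h1 := leq_dim_orthov U; have h2 := leq_dim_orthov U^C.
have := dimv_sum_cap (orthov f U) (orthov f U^C).
rewrite -orthov_addv addv_complf (eqP fnd) dimv0.
have := dimvS (subvf (orthov f U + orthov f U^C)%VS).
have := dimv_compl U; have := dimvS (subvf U); lia.
Qed.

Lemma orthovK U : orthov f (orthov f U) = U.
Proof.
apply/esym/eqv_dim; first by rewrite orthov_sym.
have := dim_orthov U; have := dim_orthov (orthov f U); lia.
Qed.

End Polarity.

Section UnitaryChambers.
Variables (F : finFieldType) (theta : {rmorphism F -> F}) (n : nat).
Variable f : {hermitian_sym 'rV[F]_(2 * n) for theta}.
Hypotheses (n_gt0 : (0 < n)%N) (fnd : nondegenerate f).
Local Notation m := (2 * n)%N.
Local Notation chamber := (chamber F m).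
Implicit Types (C B : chamber).

Definition unitary_chamber C : bool :=
  [forall i : 'I_n, part C (n + i) == orthov f (part C (n - i))].

Lemma dim_orthov_part C i : (i <= m)%N -> \dim (orthov f (part C i)) = (m - i)%N.
Proof.
move=> im; have := dim_orthov fnd (part C i).
rewrite part_dim // dimvf /dim /= mul1n; lia.
Qed.

Lemma unitary_chamberP C : reflect
  (forall i, (i <= m)%N -> part C (m - i) = orthov f (part C i))
  (unitary_chamber C).
Proof.
apply: (iffP forallP) => [h|h i]; last first.
  have := ltn_ord i => hi; rewrite -h; last lia.
  by apply/eqP; congr part; lia.
have low i : (i <= n)%N -> part C (m - i) = orthov f (part C i).
  case: (posnP i) => [->|i0] im; first by rewrite subn0 partm part0 orthov0.
  have hj : (n - i < n)%N by lia.
  have /eqP := h (Ordinal hj) => /=.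
  have -> : (n + (n - i) = m - i)%N by lia.
  by have -> : (n - (n - i) = i)%N by lia.
move=> i im; have [|ni] := leqP i n; first exact: low.
have e : part C (m - (m - i)) = orthov f (part C (m - i)) by apply: low; lia.
by rewrite subKn // in e; rewrite e orthovK.
Qed.

Lemma unitary_chamber_mid C : unitary_chamber C -> part C n = orthov f (part C n).
Proof.
move=> /unitary_chamberP/(_ n) h; rewrite -h; last lia.
by congr part; lia.
Qed.

Lemma card_unitary_lower B : part B n = orthov f (part B n) ->
  #|[pred C | eqout n m C B && unitary_chamber C]| = 1%N.
Proof.
move=> Bn; have [||C0 C0E] := @mk_chamber F m
    (fun i => if (i <= n)%N then part B i else orthov f (part B (m - i))).
- move=> i im; case: ifP => _; first exact: part_dim.
  by rewrite dim_orthov_part; lia.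
- move=> i im; case: (ltngtP i n) => hi.
  + by apply: part_le; lia.
  + by apply: orthov_anti => //; apply: part_le; lia.
  + by rewrite hi {1}Bn; apply: orthov_anti => //; apply: part_le; lia.
rewrite (@card_pred_le1 _ _ C0) => [|C /andP[/eqoutP CB /unitary_chamberP CU]]; last first.
  apply: chamber_eqP => i hi; rewrite C0E; last lia.
  case: leqP => hin; first by rewrite CB ?hin //; lia.
  rewrite -CB; [|lia|lia]; rewrite -CU; last lia.
  by congr part; lia.
apply/eqP; rewrite eqb1 inE; apply/andP; split.
  apply/eqoutP => i im /orP[hi|hi]; first by rewrite C0E // hi.
  by have -> : i = m; [lia|rewrite !partm].
apply/unitary_chamberP => i im; rewrite !C0E; [|lia|lia].
case: (ltngtP i n) => hi.
- by have -> : (m - i <= n)%N = false; [lia|rewrite subKn].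
- by have -> : (m - i <= n)%N; [lia|rewrite orthovK].
- by have -> : (m - i <= n)%N; [lia|rewrite hi -Bn; congr part; lia].
Qed.

Lemma card_unitary_upper B : part B n = orthov f (part B n) ->
  #|[pred C | eqout 0 n C B && unitary_chamber C]| = 1%N.
Proof.
move=> Bn; have [||C0 C0E] := @mk_chamber F m
    (fun i => if (i < n)%N then orthov f (part B (m - i)) else part B i).
- move=> i im; case: ifP => _; last exact: part_dim.
  by rewrite dim_orthov_part; lia.
- move=> i im; case: (ltngtP i.+1 n) => hi.
  + by apply: orthov_anti => //; apply: part_le; lia.
  + by apply: part_le; lia.
  + by rewrite hi Bn; apply: orthov_anti => //; apply: part_le; lia.
rewrite (@card_pred_le1 _ _ C0) => [|C /andP[/eqoutP CB /unitary_chamberP CU]]; last first.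
  apply: chamber_eqP => i hi; rewrite C0E; last lia.
  case: ltnP => hin; last by rewrite CB ?hin ?orbT //; lia.
  rewrite -CB; [|lia|lia]; rewrite -CU; last lia.
  by congr part; lia.
apply/eqP; rewrite eqb1 inE; apply/andP; split.
  apply/eqoutP => i im /orP[hi|hi]; last by rewrite C0E // ltnNge hi.
  by have -> : i = 0%N; [lia|rewrite !part0].
apply/unitary_chamberP => i im; rewrite !C0E; [|lia|lia].
case: (ltngtP i n) => hi.
- by have -> : (m - i < n)%N = false; [lia|rewrite orthovK].
- by have -> : (m - i < n)%N; [lia|rewrite subKn].
- by have -> : (m - i < n)%N = false; [lia|rewrite hi -Bn; congr part; lia].
Qed.

Lemma card_eqout_z_num l k B : (l <= k <= m)%N -> (k - l = n)%N ->
  #|[pred C | eqout l k C B]|%:R = z_num n #|F|.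
Proof.
move=> hlk kl; have q_gt1 := card_finNzRing_gt1 F.
have q1 : #|F|%:R - 1 != 0 :> rat by rewrite subr_eq0 pnatr_eq1 gtn_eqF.
have := congr1 (fun x => x%:R : rat) (card_eqout B hlk).
rewrite kl natrM natrX natrB ?(ltnW q_gt1) // natr_prod /z_num => h.
apply: (mulIf (expf_neq0 n q1)); rewrite h mulrAC mulVf ?expf_neq0 // mul1r.
apply: eq_bigr => i _; rewrite natrB ?natrX //.
by rewrite expn_gt0 (ltnW q_gt1).
Qed.

Lemma v_f_indicator C : part C n = orthov f (part C n) ->
  v_f f C = 1 - z_num n #|F| * (unitary_chamber C)%:R.
Proof.
move=> Cn; rewrite /v_f -/(unitary_chamber C); case: (unitary_chamber C).
  by rewrite mulr1 opprB.
by rewrite -Cn eqxx mulr0 subr0.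
Qed.

Lemma v_f_eq0 C : part C n != orthov f (part C n) -> v_f f C = 0.
Proof.
move=> Cn; rewrite /v_f -/(unitary_chamber C) (negPf Cn).
by case: ifP => // /unitary_chamber_mid h; move: Cn; rewrite -h eqxx.
Qed.

Lemma sum_v_f_class l k B : (l, k) \in [:: (0, n); (n, m)]%N ->
  \sum_(C | eqout l k C B) v_f f C = 0.
Proof.
move=> lk.
have [hlk hkl hl] : [/\ (l <= k <= m)%N, (k - l = n)%N & (n <= l) || (k <= n)]%N.
  by move: lk; rewrite !inE => /orP[]/eqP[-> ->]; split; lia.
have CBn C : eqout l k C B -> part C n = part B n by move=> /eqoutP; apply; [lia|].
have [Bn|Bn] := eqVneq (part B n) (orthov f (part B n)); last first.
  by apply: big1 => C /CBn e; apply: v_f_eq0; rewrite e.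
rewrite (eq_bigr (fun C => 1 - z_num n #|F| * (unitary_chamber C)%:R)); last first.
  by move=> C /CBn e; apply: v_f_indicator; rewrite e.
rewrite sumrB -mulr_sumr sum_indicator.
have -> : #|[pred C | eqout l k C B & unitary_chamber C]| = 1%N.
  move: lk; rewrite !inE => /orP[]/eqP[-> ->].
    exact: card_unitary_upper.
  exact: card_unitary_lower.
by rewrite mulr1 sumr_const -(card_eqout_z_num B hlk hkl) subrr.
Qed.

Lemma sum_class_function_v_f (R : numFieldType) l k (g : chamber -> R) :
  (l, k) \in [:: (0, n); (n, m)]%N ->
  (forall C D, eqout l k C D -> g C = g D) ->
  \sum_C g C * ratr (v_f f C) = 0.
Proof.
move=> lk hg.
have [hlk hkl] : (l <= k <= m)%N /\ (k - l = n)%N.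
  by move: lk; rewrite !inE => /orP[]/eqP[-> ->]; split; lia.
pose z : R := ratr (z_num n #|F|).
have card B : #|[pred C | eqout l k C B]|%:R = z.
  by rewrite /z -(card_eqout_z_num B hlk hkl) ratr_nat.
have z0 : z != 0.
  rewrite -(card (chamber_exists F m)) pnatr_eq0 -lt0n.
  by apply/card_gt0P; exists (chamber_exists F m); rewrite inE eqout_refl.
apply: (mulfI z0); rewrite mulr0 mulr_sumr.
transitivity (\sum_C \sum_(B | eqout l k B C) g B * ratr (v_f f C)).
  apply: eq_bigr => C _.
  rewrite (eq_bigr (fun=> g C * ratr (v_f f C))) => [|B /hg -> //].
  by rewrite sumr_const -[RHS]mulr_natl card.
rewrite (exchange_big_dep xpredT) //=; apply: big1 => B _.
rewrite -mulr_sumr -raddf_sum (eq_bigl (fun C => eqout l k C B)).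
  by rewrite sum_v_f_class // raddf0 mulr0.
by move=> C; rewrite eqout_sym.
Qed.

End UnitaryChambers.

Theorem theorem3p14 (R : realType) (n : nat) (hn : (1 <= n)%N)
    (F : finFieldType) (q r : nat) (hF : #|F| = q) (hq : q = (r ^ 2)%N)
    (theta : {rmorphism F -> F}) (htheta : forall x : F, theta x = x ^+ r)
    (f : {hermitian_sym 'rV[F]_(2 * n) for theta}) (hf : is_unitary f) :
  antidesign R (v_f f) /\ \sum_(C : chamber F (2 * n)) v_f f C = 0.
Proof.
have fnd := hf.1; have m1 : (1 < 2 * n)%N by lia.
have q_gt0 : 0 < #|F|%:R :> R by rewrite ltr0n (ltnW (card_finNzRing_gt1 F)).
split; last first.
  apply/eqP; rewrite -(fmorph_eq0 (ratr : rat -> R)) raddf_sum; apply/eqP.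
  have := @sum_class_function_v_f F theta n f hn fnd R 0 n (fun=> 1).
  rewrite mem_head => /(_ isT (fun _ _ _ => erefl)).
  by under eq_bigr do rewrite mul1r.
set e := (n * (2 * n - 2))%N; have he : (2 * e = 2 * n * (2 * n - 2))%N by rewrite mulnA.
pose a : R := - #|F|%:R ^+ e.
have a_lt0 : a < 0 by rewrite oppr_lt0 exprn_gt0.
have a2 : a ^+ 2 = #|F|%:R ^+ (2 * n * (2 * n - 2)) by rewrite sqrrN -exprM mulnC he.
exists a.
  rewrite -oppmx0; split.
    have [u u0 hu] := @exists_eigenvector R F _ e m1 he.
    by apply/eigenvalueP; exists u.
  move=> b hb; have [b0|b0] := leP 0 b; first exact: le_trans (ltW a_lt0) b0.
  have := negative_eigenvalue_bound m1 b0 hb; rewrite -a2 -[b ^+ 2]sqrrN -[a ^+ 2]sqrrN.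
  by rewrite ler_pXn2r ?nnegrE ?oppr_ge0 ?(ltW b0) ?(ltW a_lt0) // lerN2.
move=> v; rewrite -oppmx0 => hv.
have [u [w [-> hu hw]]] := extremal_eigenvector m1 a_lt0 (erefl _) a2 hv.
under eq_bigr do rewrite mxE mulrDl.
rewrite big_split /=.
rewrite (@sum_class_function_v_f _ _ _ _ hn fnd R n (2 * n)) ?inE ?eqxx ?orbT //.
by rewrite (@sum_class_function_v_f _ _ _ _ hn fnd R 0 n) ?inE ?eqxx // addr0.
Qed.
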